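(* Let $j\in C^2(\mathbb{R}^3)^3$ satisfy $j\neq 0$ everywhere in $\mathbb{R}^3$ and $\operatorname{div} j=0$ in $\mathbb{R}^3$, and assume that at every point of $\mathbb{R}^3$ the triple $(j,\operatorname{curl} j,\,j\times\operatorname{curl} j)$ is an orthogonal basis of $\mathbb{R}^3$. Let $X_1,X_2,X_3$ be the flows along $j/|j|$, $\operatorname{curl} j/|\operatorname{curl} j|$ and $(j\times\operatorname{curl} j)/|j|^2$ respectively, and assume that $X_3$ is defined on the whole of $\mathbb{R}\times\mathbb{R}^3$. Fix $x_0\in\mathbb{R}^3$, set $$X_{32}(t_3,t_2,t_1):=X_3\big(t_3,X_2(t_2,X_1(t_1,x_0))\big),\qquad (t_1,t_2,t_3)\in\mathbb{R}^3,$$ and assume that the map $(t_1,t_2,t_3)\mapsto X_{32}(t_3,t_2,t_1)$ is a $C^1$-diffeomorphism from $\mathbb{R}^3$ onto $\mathbb{R}^3$. Let $w:\mathbb{R}^3\to\mathbb{R}$ be the function defined by $$w\big(X_{32}(t_3,t_2,t_1)\big):=\int_0^{t_3}\frac{|\operatorname{curl} j|^2}{|j|^2}\big(X_{32}(s,t_2,t_1)\big)\,ds,\qquad (t_1,t_2,t_3)\in\mathbb{R}^3.$$ Then $j$ is isotropically realizable in $\mathbb{R}^3$ (in the sense defined in the context) with the conductivity $\sigma=e^w\in C^1(\mathbb{R}^3)$.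
   Context: Definition: a divergence free field $j$ in $L^\infty(\mathbb{R}^3)^3$ (taken regular in what follows) is said to be isotropically realizable in $\mathbb{R}^3$ as a current field if there exist an isotropic (scalar) conductivity $\sigma>0$ with $\sigma,\sigma^{-1}\in L^\infty(\mathbb{R}^3)$ and a potential $u\in W^{1,\infty}(\mathbb{R}^3)$ such that $j=\sigma\nabla u$; it is realizable with the conductivity $\sigma$ when this holds for that $\sigma$. The flows are the solutions, for $(t,x)\in\mathbb{R}\times\mathbb{R}^3$, of $$\frac{\partial X_1}{\partial t}(t,x)=\frac{j}{|j|}\big(X_1(t,x)\big),\quad \frac{\partial X_2}{\partial t}(t,x)=\frac{\operatorname{curl} j}{|\operatorname{curl} j|}\big(X_2(t,x)\big),\quad \frac{\partial X_3}{\partial t}(t,x)=\frac{j\times\operatorname{curl} j}{|j|^2}\big(X_3(t,x)\big),$$ with $X_i(0,x)=x$ for $i=1,2,3$. The flows $X_1$ and $X_2$ are defined on all of $\mathbb{R}\times\mathbb{R}^3$, because the corresponding vector fields are $C^1$ and bounded. $|\cdot|$ is the Euclidean norm.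
   Formalization: Realizability is taken locally: σ, σ^{-1} in L^∞_loc(R^3) and u in W^{1,∞}_loc(R^3), with j not required bounded; with global L^∞ and W^{1,∞} the claim fails, e.g. j=(2+tanh y,0,0) gives u=2x+c, which is unbounded. *)

(* Defs.v *)
From HB Require Import structures.
From mathcomp Require Import all_boot all_order all_algebra.
From mathcomp Require Import all_classical all_reals all_analysis.

Set Implicit Arguments.
Unset Strict Implicit.
Unset Printing Implicit Defensive.

Import Order.TTheory GRing.Theory Num.Theory.
Import numFieldNormedType.Exports.

Local Open Scope classical_set_scope.
Local Open Scope ring_scope.

(* R^3 is 'rV[R]_3, with coordinates numbered 0, 1, 2. The norm `|x| that the
   library puts on it is the sup norm; it is only used through the topology and
   the derivatives, which do not depend on the choice of a norm. *)

Definition dot3 (R : realType) (u v : 'rV[R]_3) : R :=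
  \sum_(i < 3) u 0 i * v 0 i.

Definition enorm (R : realType) (u : 'rV[R]_3) : R := Num.sqrt (dot3 u u).

(* Indices are added modulo 3 in 'I_3. *)
Definition cross (R : realType) (u v : 'rV[R]_3) : 'rV[R]_3 :=
  \row_(k < 3) (u 0 (k + 1) * v 0 (k + 2) - u 0 (k + 2) * v 0 (k + 1)).

Definition partial (R : realType) (i : 'I_3) (f : 'rV[R]_3 -> R)
    (x : 'rV[R]_3) : R :=
  'D_(delta_mx 0 i) f x.

Definition comp3 (R : realType) (F : 'rV[R]_3 -> 'rV[R]_3) (i : 'I_3)
    (x : 'rV[R]_3) : R :=
  F x 0 i.

Definition divergence (R : realType) (F : 'rV[R]_3 -> 'rV[R]_3)
    (x : 'rV[R]_3) : R :=
  \sum_(i < 3) partial i (comp3 F i) x.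

Definition curl (R : realType) (F : 'rV[R]_3 -> 'rV[R]_3)
    (x : 'rV[R]_3) : 'rV[R]_3 :=
  \row_(k < 3) (partial (k + 1) (comp3 F (k + 2)) x
                - partial (k + 2) (comp3 F (k + 1)) x).

(* In finite dimension, f is C^(k+1) iff it is Frechet differentiable and each
   x |-> 'd f x v = 'D_v f x is C^k. *)
Fixpoint Ck (R : realType) (W : normedModType R) (k : nat)
    (f : 'rV[R]_3 -> W) : Prop :=
  match k with
  | 0%N => continuous f
  | k'.+1 => (forall x, differentiable f x) /\ (forall v, Ck k' ('D_v f))
  end.

Definition C1_diffeomorphism (R : realType) (f : 'rV[R]_3 -> 'rV[R]_3) : Prop :=
  exists g : 'rV[R]_3 -> 'rV[R]_3,
    [/\ cancel f g, cancel g f, Ck 1 f & Ck 1 g].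

Definition orthogonal_basis (R : realType) (u v z : 'rV[R]_3) : Prop :=
  [/\ basis_of fullv [:: u; v; z], dot3 u v = 0, dot3 u z = 0 & dot3 v z = 0].

Definition is_flow (R : realType) (F : 'rV[R]_3 -> 'rV[R]_3)
    (X : R -> 'rV[R]_3 -> 'rV[R]_3) : Prop :=
  (forall x, X 0 x = x) /\
  (forall (t : R) x, is_derive t 1 (X ^~ x) (F (X t x))).

(* The integral from a to b, with the usual sign when b < a. *)
Definition oriented_integral (R : realType) (a b : R) (f : R -> R) : R :=
  if a <= b then \int[lebesgue_measure]_(s in `[a, b]) f s
  else - \int[lebesgue_measure]_(s in `[b, a]) f s.

(* Lebesgue measure on R^3 is the threefold product measure on R * R * R, and
   point3 identifies R * R * R with 'rV[R]_3. *)
Definition leb3 (R : realType) :=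
  ((@lebesgue_measure R \x @lebesgue_measure R) \x @lebesgue_measure R)%E.

Definition point3 (R : realType) (p : R * R * R) : 'rV[R]_3 :=
  \row_(i < 3) [:: p.1.1; p.1.2; p.2]`_i.

Definition ae3 (R : realType) (P : 'rV[R]_3 -> Prop) : Prop :=
  {ae @leb3 R, forall p, P (point3 p)}.

Definition integral3 (R : realType) (f : 'rV[R]_3 -> R) : R :=
  \int[@leb3 R]_p f (point3 p).

Definition Linfty_loc (R : realType) (f : 'rV[R]_3 -> R) : Prop :=
  forall K : set 'rV[R]_3, compact K ->
    (f \_ K) \o @point3 R \in Lfun (@leb3 R) +oo%E.

Definition test_function (R : realType) (phi : 'rV[R]_3 -> R) : Prop :=
  (forall k, Ck k phi) /\ compact (closure [set x | phi x != 0]).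

Definition weak_gradient (R : realType) (u : 'rV[R]_3 -> R)
    (g : 'rV[R]_3 -> 'rV[R]_3) : Prop :=
  forall (phi : 'rV[R]_3 -> R) (i : 'I_3), test_function phi ->
    integral3 (fun x => u x * partial i phi x)
    = - integral3 (fun x => comp3 g i x * phi x).

(* u belongs to W^{1,oo}_loc(R^3) with weak gradient g. *)
Definition W1infty_loc (R : realType) (u : 'rV[R]_3 -> R)
    (g : 'rV[R]_3 -> 'rV[R]_3) : Prop :=
  [/\ Linfty_loc u, forall i, Linfty_loc (comp3 g i) & weak_gradient u g].

(* j = sigma * grad u. The spaces L^oo and W^{1,oo} over the whole (unbounded)
   space R^3 are understood locally: the bounds are uniform on each compact set,
   not on R^3. With uniform bounds the theorem fails, since its hypotheses bound
   none of j, w and u: for j = (exp y, 0, 0) in coordinates (x, y, z) and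
   x0 = 0, all of them hold and w = y, so neither sigma = exp y nor its inverse
   is bounded. Even when j, sigma and 1 / sigma are bounded, as for
   j = (2 + tanh y, 0, 0), the potential u = c * x + d is not. *)
Definition isotropically_realizable_with (R : realType)
    (j : 'rV[R]_3 -> 'rV[R]_3) (sigma : 'rV[R]_3 -> R) : Prop :=
  [/\ forall x, 0 < sigma x,
      Linfty_loc sigma,
      Linfty_loc (fun x => (sigma x)^-1) &
      exists (u : 'rV[R]_3 -> R) (gradu : 'rV[R]_3 -> 'rV[R]_3),
        W1infty_loc u gradu /\ ae3 (fun x => j x = sigma x *: gradu x)].

(* Main.v *)
Require Import Defs.
From HB Require Import structures.
From mathcomp Require Import all_boot all_order all_algebra.
From mathcomp Require Import all_classical all_reals all_analysis.
From mathcomp Require Import measurable_realfun ess_sup_inf ring lra.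
Import Order.TTheory GRing.Theory Num.Theory.
Import numFieldNormedType.Exports.
Local Open Scope classical_set_scope.
Local Open Scope ring_scope.

(** Write [Phi (t1, t2, t3) = X32 t3 t2 t1] and consider the pullback
    [sum_i A_i dt_i], [A_i = j(Phi) . d_i Phi], of the 1-form of [j].  If [j . N = 0]
    and [d_k Phi = N(Phi)], then [d_k A_i = (curl j x N) . d_i Phi], because exterior
    differentiation commutes with pullbacks.  For [N = (j x curl j) / |j|^2] the vector
    [curl j x N] is [|curl j|^2 / |j|^2] times [j], so [A_i = e^w A_i(t1, t2, 0)]; for
    [N = curl j / |curl j|] it vanishes, so on [t3 = 0] the [A_i] do not depend on [t2].
    Hence the pullback of [j] is [e^w h(t1) dt1] with [h(t1) = |j|(X1(t1, x0))], and
    [u = H o (Phi^-1)_1], with [H' = h], satisfies [grad u = e^-w j]. *)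

(** The order of composition decides where each flow is visible: [X3] acts last, so d_3 Phi =
    n3(Phi) holds everywhere, whereas d_2 Phi = n2(Phi) is available only on t3 = 0 and d_1 Phi =
    j/|j| only on t2 = t3 = 0. The coefficients therefore have to be transported back, first along
    t3 and then along t2, to the places where they are known. There A_2 and A_3 vanish because [j]
    is orthogonal to the other two fields, and A_1 is j . j/|j| = |j|.

    Only d_k d_i Phi is needed, and it exists since d_k Phi = N(Phi) is itself C^1: this calls for a
    form of Schwarz' theorem that produces one mixed derivative from the other. Likewise [w] is
    given as an integral in t3 alone, and its derivatives in t1 and t2 come from differentiation
    under the integral sign. The potential obtained is a classical C^1 function; Fubini's theorem
    turns its gradient into a weak one. *)

Lemma is_derive_line (R : realType) (V W : normedModType R) (f : V -> W)
    (p v : V) (s : R) (df : W) :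
  is_derive s 1 (fun r : R => f (r *: v + p)) df <->
  is_derive (s *: v + p) v f df.
Proof.
have E : (fun h : R => h^-1 *: ((f \o shift (s *: v + p)) (h *: v)
            - f (s *: v + p))) =
   (fun h : R => h^-1 *: (((fun r : R => f (r *: v + p)) \o shift s) (h *: 1)
            - f (s *: v + p))).
  apply/funext => h /=.
  by rewrite [h *: 1]mulr1 scalerDl addrA.
split=> -[dv de]; constructor.
- by rewrite /derivable E.
- by rewrite -de /derive E.
- by rewrite /derivable -E.
- by rewrite -de /derive -E.
Qed.

(** * Continuity of sums, products and row vectors *)

Section continuity.
Context {R : realType} {T : topologicalType}.
Implicit Types f g : T -> R.

Lemma continuous_funD f g : continuous f -> continuous g ->
  continuous (fun x => f x + g x).
Proof. by move=> cf cg x; apply: cvgD; [exact: cf|exact: cg]. Qed.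

Lemma continuous_funM f g : continuous f -> continuous g ->
  continuous (fun x => f x * g x).
Proof. by move=> cf cg x; apply: cvgM; [exact: cf|exact: cg]. Qed.

Lemma continuous_fun_sum n (h : 'I_n -> T -> R) :
  (forall i, continuous (h i)) -> continuous (fun x => \sum_(i < n) h i x).
Proof.
move=> ch x; elim: n h ch => [|n IH] h ch.
  under [X in continuous_at x X]eq_fun do rewrite big_ord0.
  exact: cst_continuous.
under [X in continuous_at x X]eq_fun do rewrite big_ord_recl.
by apply: cvgD; [exact: ch|apply: IH => i; exact: ch].
Qed.

Lemma continuous_row n (h : 'I_n -> T -> R) :
  (forall i, continuous (h i)) -> continuous (fun x => \row_(i < n) h i x).
Proof.
move=> ch x; apply/cvgrPdist_le => /= e e0.
near=> y.
rewrite /Num.Def.normr/= mx_normrE (bigmax_le _ (ltW e0))//= => -[i k] _.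
rewrite !mxE/=.
move: k; near: y; apply: filter_forall => /= k.
by have /cvgrPdist_le := ch k x; exact.
Unshelve. all: by end_near. Qed.

End continuity.

(** * Calculus of C^1 functions on R^3 *)

Section C1.
Context {R : realType}.
Local Notation E := 'rV[R]_3.
Implicit Types (f g : E -> R) (F G : E -> E).

Lemma rV_sum_delta (v : E) : v = \sum_(i < 3) v 0 i *: delta_mx 0 i.
Proof. exact: row_sum_delta. Qed.

Lemma Ck1_continuous (W : normedModType R) (f : E -> W) : Ck 1 f -> continuous f.
Proof. by move=> [df _] x; exact: differentiable_continuous. Qed.

Lemma Ck1_is_derive (W : normedModType R) (f : E -> W) x v :
  Ck 1 f -> is_derive x v f ('D_v f x).
Proof. by move=> [df _]; apply/derivableP/diff_derivable. Qed.

Lemma derive_coord F (v x : E) (k : 'I_3) : differentiable F x ->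
  'D_v F x 0 k = 'D_v (comp3 F k) x.
Proof. by move=> dF; rewrite derive_mx ?mxE//; exact: diff_derivable. Qed.

Lemma Ck1_comp3 F k : Ck 1 F -> Ck 1 (comp3 F k).
Proof.
move=> [dF cF]; split=> [x|v].
  apply: (@differentiable_comp _ _ _ _ F (fun M : E => M 0 k)) => //.
  exact: differentiable_coord.
have -> : 'D_v (comp3 F k) = (fun M : E => M 0 k) \o 'D_v F.
  by apply/funext => x /=; rewrite derive_coord.
move=> x; apply: continuous_comp; first exact: cF.
exact: coord_continuous.
Qed.

Lemma derive_sum_partial f (v x : E) : differentiable f x ->
  'D_v f x = \sum_(i < 3) v 0 i * partial i f x.
Proof.
move=> df; rewrite deriveE// {1}(rV_sum_delta v) linear_sum.
by apply: eq_bigr => i _; rewrite linearZ /partial deriveE.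
Qed.

(** [Ck] quantifies over all directions; linearity of the differential reduces the continuity
    requirement to the three axes. *)
Lemma Ck1_partial f : (forall x, differentiable f x) ->
  (forall i, continuous (partial i f)) -> Ck 1 f.
Proof.
move=> df cf; split=> // v.
have -> : 'D_v f = fun x => \sum_(i < 3) v 0 i * partial i f x.
  by apply/funext => x; rewrite derive_sum_partial.
apply: continuous_fun_sum => i.
by apply: continuous_funM => // x; exact: cst_continuous.
Qed.

Lemma derive_comp_partial f F (v x : E) :
  differentiable F x -> differentiable f (F x) ->
  'D_v (f \o F) x = \sum_(i < 3) 'D_v (comp3 F i) x * partial i f (F x).
Proof.
move=> dF df; rewrite deriveE; last exact: differentiable_comp.
rewrite diff_comp//= -(deriveE _ df) derive_sum_partial//.
by apply: eq_bigr => i _; rewrite -deriveE// derive_coord.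
Qed.

Lemma Ck1_comp f F : Ck 1 f -> Ck 1 F -> Ck 1 (f \o F).
Proof.
move=> f1 F1; have [[df cf] [dF cF]] := (f1, F1).
split=> [x|v]; first exact: differentiable_comp.
have -> : 'D_v (f \o F) =
    fun x => \sum_(i < 3) 'D_v (comp3 F i) x * partial i f (F x).
  by apply/funext => x; rewrite derive_comp_partial.
apply: continuous_fun_sum => i.
apply: continuous_funM; first by have [_] := Ck1_comp3 F i F1; exact.
by move=> x; apply: continuous_comp; [exact: Ck1_continuous|exact: cf].
Qed.

Lemma Ck1D f g : Ck 1 f -> Ck 1 g -> Ck 1 (fun x => f x + g x).
Proof.
move=> [df cf] [dg cg]; split=> [x|v]; first exact: differentiableD.
have -> : 'D_v (fun x => f x + g x) = 'D_v f \+ 'D_v g.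
  by apply/funext => x; rewrite deriveD//; exact: diff_derivable.
by move=> x; apply: continuousD; [exact: cf|exact: cg].
Qed.

Lemma Ck1N f : Ck 1 f -> Ck 1 (fun x => - f x).
Proof.
move=> [df cf]; split=> [x|v]; first exact: differentiableN.
have -> : 'D_v (fun x => - f x) = \- 'D_v f.
  by apply/funext => x; rewrite deriveN//; exact: diff_derivable.
by move=> x; apply: continuousN; exact: cf.
Qed.

Lemma deriveM_pt f g (v x : E) : differentiable f x -> differentiable g x ->
  'D_v (fun x => f x * g x) x = f x * 'D_v g x + g x * 'D_v f x.
Proof. by move=> df dg; rewrite deriveM//; exact: diff_derivable. Qed.

Lemma Ck1M f g : Ck 1 f -> Ck 1 g -> Ck 1 (fun x => f x * g x).
Proof.
move=> f1 g1; have [[df cf] [dg cg]] := (f1, g1).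
split=> [x|v]; first exact: differentiableM.
have -> : 'D_v (fun x => f x * g x) =
    fun x => f x * 'D_v g x + g x * 'D_v f x.
  by apply/funext => x; rewrite deriveM_pt.
by apply: continuous_funD; apply: continuous_funM => //; exact: Ck1_continuous.
Qed.

Lemma derive_comp1 (h dh : R -> R) f (v x : E) : differentiable f x ->
  is_derive (f x) 1 h (dh (f x)) -> 'D_v (h \o f) x = dh (f x) * 'D_v f x.
Proof.
move=> df hh.
have dhh : differentiable h (f x) by apply/derivable1_diffP; case: hh.
rewrite deriveE; last exact: differentiable_comp.
rewrite diff_comp//= diff1E// derive1E derive_val -deriveE//.
by rewrite [LHS]mulrC.
Qed.

(** The conditions on [h] and [dh] are imposed only at values of [f], so that inversion and the
    square root, which are singular at 0, can be used. *)
Lemma Ck1_comp1 (h dh : R -> R) f : Ck 1 f ->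
  (forall x, is_derive (f x) 1 h (dh (f x))) ->
  (forall x, {for f x, continuous dh}) -> Ck 1 (h \o f).
Proof.
move=> f1 hh ch; have [df cf] := f1.
split=> [x|v].
  apply: differentiable_comp => //.
  by apply/derivable1_diffP; case: (hh x).
have -> : 'D_v (h \o f) = fun x => dh (f x) * 'D_v f x.
  by apply/funext => x; exact: derive_comp1.
apply: continuous_funM => // x.
by apply: continuous_comp; [exact: Ck1_continuous|exact: ch].
Qed.

Lemma Ck1_expR f : Ck 1 f -> Ck 1 (expR \o f).
Proof.
move=> f1; apply: (Ck1_comp1 expR expR f f1) => x.
exact: continuous_expR.
Qed.

Lemma Ck1V f : Ck 1 f -> (forall x, f x != 0) -> Ck 1 (fun x => (f x)^-1).
Proof.
move=> f1 f0; apply: (Ck1_comp1 GRing.inv (fun r => - r ^- 2) f f1) => x.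
  have := @is_deriveV R (fun r => r) (f x) 1 1 (f0 x) _.
  by rewrite /= => H; apply: is_derive_eq; rewrite scaler1.
apply: continuousN; apply: continuousV; first by rewrite expf_neq0.
exact: exprn_continuous.
Qed.

Lemma Ck1_sqrt f : Ck 1 f -> (forall x, 0 < f x) ->
  Ck 1 (fun x => Num.sqrt (f x)).
Proof.
move=> f1 f0; apply: (Ck1_comp1 Num.sqrt (fun r => (2 * Num.sqrt r)^-1) f f1) => x.
  exact: is_derive1_sqrt.
apply: continuousV; first by rewrite mulf_neq0// gt_eqF// sqrtr_gt0.
by apply: continuousM; [exact: cst_continuous|exact: sqrt_continuous].
Qed.

Lemma Ck1_sum (h : 'I_3 -> E -> R) : (forall i, Ck 1 (h i)) ->
  Ck 1 (fun x => \sum_(i < 3) h i x).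
Proof.
move=> h1; under eq_fun do rewrite !big_ord_recl big_ord0.
rewrite -/(Ck 1 _); do ?apply: Ck1D => //.
split=> [x|v]; first exact: differentiable_cst.
have -> : 'D_v (fun _ : E => 0 : R) = cst 0.
  by apply/funext => x; rewrite derive_cst.
by move=> x; exact: cst_continuous.
Qed.

Lemma Ck1_id : Ck 1 (fun x : E => x).
Proof.
split=> [x|v]; first by have [] := is_diff_id x.
have -> : 'D_v (fun x : E => x) = cst v by apply/funext => x; rewrite derive_id.
by move=> x; exact: cst_continuous.
Qed.

Lemma Ck1_coord (i : 'I_3) : Ck 1 (fun x : E => x 0 i).
Proof. exact: (Ck1_comp3 _ i Ck1_id). Qed.

Lemma derive_coordE (i : 'I_3) (v x : E) : 'D_v (fun x : E => x 0 i) x = v 0 i.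
Proof.
have := derive_coord (fun x : E => x) v x i.
by rewrite derive_id => <-//; have [] := is_diff_id x.
Qed.

Lemma Ck1_cst (c : R) : Ck 1 (fun _ : E => c).
Proof.
split=> [x|v]; first exact: differentiable_cst.
have -> : 'D_v (fun _ : E => c) = cst 0.
  by apply/funext => x; rewrite derive_cst.
by move=> x; exact: cst_continuous.
Qed.

Lemma Ck1_row (h : 'I_3 -> E -> R) : (forall i, Ck 1 (h i)) ->
  Ck 1 (fun x => \row_(i < 3) h i x).
Proof.
move=> h1.
have dr x : differentiable (fun x => \row_(i < 3) h i x) x.
  have -> : (fun x => \row_(i < 3) h i x) =
      \sum_(i < 3) (fun x => h i x *: (delta_mx 0 i : E)).
    apply/funext => y; rewrite [LHS]rV_sum_delta fct_sumE.
    by apply: eq_bigr => i _; rewrite mxE.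
  apply: differentiable_sum => i; apply: differentiableZl.
  by have [] := h1 i.
split=> // v.
have -> : 'D_v (fun x => \row_(i < 3) h i x) = fun x => \row_i 'D_v (h i) x.
  apply/funext => x; apply/rowP => i; rewrite derive_coord// mxE.
  by congr ('D_v _ x); apply/funext => y; rewrite /comp3 mxE.
by apply: continuous_row => i; have [_] := h1 i; exact.
Qed.

End C1.

(** * Mean values, exchange of mixed derivatives, and the fundamental theorem of calculus *)

Section one_variable.
Context {R : realType}.
Implicit Types f df : R -> R.

Lemma mean_value_inequality f df (b M : R) :
  (forall s : R, is_derive s 1 f (df s)) ->
  (forall s, `|s| <= `|b| -> `|df s| <= M) ->
  `|f b - f 0| <= M * `|b|.
Proof.
move=> hf hM.
have cf (A : set R) : {within A, continuous f}.
  apply: continuous_subspaceT => s.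
  by apply/differentiable_continuous/derivable1_diffP; case: (hf s).
have [b0|b0] := leP 0 b.
  have [c] := MVT_segment b0 (fun s _ => hf s) (cf _).
  rewrite in_itv/= => /andP[c0 cb] ->.
  by rewrite subr0 normrM ler_wpM2r// hM// !ger0_norm.
have [c] := MVT_segment (ltW b0) (fun s _ => hf s) (cf _).
rewrite in_itv/= => /andP[bc c0]; rewrite distrC => ->.
rewrite sub0r normrM normrN ler_wpM2r// hM//.
by rewrite (ler0_norm c0) (ler0_norm (ltW b0)) lerN2.
Qed.

Lemma is_derive_cvg (V W : normedModType R) (f : V -> W) (x v : V) (d : W) :
  is_derive x v f d <-> h^-1 *: (f (h *: v + x) - f x) @[h --> 0^'] --> d.
Proof.
split=> [[df <-]|df]; first exact: df.
have df' : derivable f x v by apply/cvg_ex; exists d; exact: df.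
by constructor=> //; apply: cvg_lim.
Qed.

Lemma is_derive_mulr (c s : R) : is_derive s 1 (fun r => r * c) c.
Proof. by apply: is_derive_eq; rewrite scaler0 add0r [LHS]mulr1. Qed.

Lemma derive_near_bound f (d a e r0 : R) :
  is_derive (0 : R) 1 f d -> 0 < r0 ->
  (forall r, `|r| < r0 -> `|f r - f 0 - r * a| <= e * `|r|) -> `|d - a| <= e.
Proof.
move=> /is_derive_cvg df r00 H; apply/ler_addgt0Pr => eta eta0.
have /cvgrPdist_le /(_ _ eta0) dfe := df.
near (0 : R)^' => h.
have h0 : h != 0 by near: h; exact: nbhs_dnbhs_neq.
have hr0 : `|h| < r0 by near: h; exact: dnbhs0_lt.
have hd : `|d - h^-1 *: (f (h *: 1 + 0) - f 0)| <= eta by near: h.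
rewrite [h *: 1]mulr1 addr0 in hd.
rewrite -(subrKA (h^-1 *: (f h - f 0))) addrC (le_trans (ler_normD _ _))// lerD//.
have -> : h^-1 *: (f h - f 0) - a = h^-1 * (f h - f 0 - h * a).
  by rewrite mulrBr mulKf.
rewrite normrM normfV mulrC ler_pdivrMr ?normr_gt0//.
exact: H.
Unshelve. all: by end_near. Qed.

(* Schwarz' theorem when only one of the two mixed derivatives is known to exist. *)
Lemma is_derive_swap (V : normedModType R) (f g fu gu : V -> R) (u v x : V) :
  (forall y, is_derive y v f (g y)) ->
  (forall y, is_derive y u f (fu y)) ->
  (forall y, is_derive y u g (gu y)) ->
  {for x, continuous gu} ->
  is_derive x v fu (gu x).
Proof.
move=> fv hfu hgu /cvgrPdist_le cgu; apply/is_derive_cvg/cvgrPdist_le => e e0.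
have /cgu/nbhs_ballP[/= d d0 hd] := e0.
(* [M] exceeds |u| + |v|, so r u + s v has norm less than [d] as soon as |r| and |s| are at most d /
   M. *)
pose M := 2 * (1 + `|u| + `|v|).
have M0 : 0 < M by rewrite mulr_gt0// -addrA ltr_pwDl// addr_ge0.
pose r0 := d / M.
have r00 : 0 < r0 by rewrite divr_gt0.
have small r s : `|r| <= r0 -> `|s| <= r0 -> `|gu x - gu (r *: u + (s *: v + x))| <= e.
  move=> rr sr; apply: hd; rewrite -ball_normE/= addrA opprD addrCA subrr addr0.
  rewrite normrN (le_lt_trans (ler_normD _ _))// !normrZ.
  have Md : r0 * M = d by rewrite /r0 divfK// gt_eqF.
  rewrite -Md /M; apply: (@le_lt_trans _ _ (r0 * (`|u| + `|v|))).
    by rewrite mulrDr lerD// ler_wpM2r.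
  rewrite ltr_pM2l//; have := normr_ge0 u; have := normr_ge0 v; lra.
near=> h.
have h0 : h != 0 by near: h; exact: nbhs_dnbhs_neq.
have hr0 : `|h| <= r0 by near: h; exact: dnbhs0_le.
suff H : `|(fu (h *: v + x) - fu x) - h * gu x| <= e * `|h|.
  have -> : gu x - h^-1 *: (fu (h *: v + x) - fu x) =
      - (h^-1 * ((fu (h *: v + x) - fu x) - h * gu x)).
    by rewrite mulrBr mulKf// opprB.
  by rewrite normrN normrM normfV mulrC ler_pdivrMr ?normr_gt0.
(* With [h] fixed, the increment of [fu] along [v] is the derivative at r = 0 of a first difference
   of [f]; it remains to bound a second difference of [f]. *)
apply: (derive_near_bound (fun r => f (r *: u + (h *: v + x)) - f (r *: u + x)) _ _ _ r0) => //.
  have H1 := (is_derive_line R V R f (h *: v + x) u 0 (fu (h *: v + x))).2.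
  have H2 := (is_derive_line R V R f x u 0 (fu x)).2.
  rewrite !scale0r !add0r in H1 H2.
  by apply: is_deriveB.
move=> r rr.
(* The second difference is read as an increment along [v], so that only the derivative [g] of [f]
   along [v] enters; the mean value inequality then leaves a first difference of [g] along [u],
   treated in the same way by [psi]. *)
pose chi s := f (s *: v + (r *: u + x)) - f (s *: v + x) - s * (r * gu x).
have -> : f (r *: u + (h *: v + x)) - f (r *: u + x) -
   (f (0 *: u + (h *: v + x)) - f (0 *: u + x)) - r * (h * gu x) = chi h - chi 0.
  rewrite /chi !scale0r !add0r mul0r subr0 (addrCA (r *: u)); ring.
have dchi (s : R) : is_derive s 1 chi
    (g (s *: v + (r *: u + x)) - g (s *: v + x) - r * gu x).
  rewrite /chi; apply: is_deriveB.
    by apply: is_deriveB; apply/is_derive_line.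
  exact: is_derive_mulr.
rewrite mulrAC; apply: (mean_value_inequality _ _ _ _ dchi).
move=> s sh.
pose psi q := g (q *: u + (s *: v + x)) - q * gu x.
have -> : g (s *: v + (r *: u + x)) - g (s *: v + x) - r * gu x = psi r - psi 0.
  rewrite /psi !scale0r !add0r mul0r subr0 (addrCA (r *: u)); ring.
have dpsi (q : R) : is_derive q 1 psi (gu (q *: u + (s *: v + x)) - gu x).
  rewrite /psi; apply: is_deriveB; first by apply/is_derive_line.
  exact: is_derive_mulr.
apply: (mean_value_inequality _ _ _ _ dpsi) => q qr.
rewrite distrC small//; first exact: (le_trans qr (ltW rr)).
exact: (le_trans sh hr0).
Unshelve. all: by end_near. Qed.

Local Notation mu := (@lebesgue_measure R).

Lemma is_derive_oriented_integral f (t : R) : continuous f ->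
  is_derive t 1 (fun t => oriented_integral 0 t f) (f t).
Proof.
move=> cf.
have itg (a b : R) : mu.-integrable `[a, b] (EFin \o f).
  apply: continuous_compact_integrable; first exact: segment_compact.
  exact: continuous_subspaceT.
(* A base point [- N] to the left of both 0 and [t] merges the two cases of the oriented integral
   into G s - G 0 on the whole neighbourhood ]-N, N[ of [t]. *)
pose N : R := `|t| + 1.
pose G (s : R) : R := \int[mu]_(r in `[- N, s]) f r.
have E (s : R) : - N < s -> s < N -> oriented_integral 0 s f = G s - G 0.
  move=> Ns sN; rewrite /oriented_integral /G.
  have N0 : 0 < N by rewrite ltr_wpDl.
  case: ifPn => [s0|]; last rewrite -ltNge => s0.
    rewrite Rintegral_itvB ?bnd_simp ?oppr_le0 ?(ltW N0)//.
    rewrite Rintegral_itv_obnd_cbnd//.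
    by apply: integrableS (itg 0 s) => //; exact: subset_itv_oc_cc.
  rewrite -[RHS]opprB; congr (- _).
  rewrite Rintegral_itvB ?bnd_simp ?(ltW Ns) ?(ltW s0)//.
  rewrite Rintegral_itv_obnd_cbnd//.
  by apply: integrableS (itg s 0) => //; exact: subset_itv_oc_cc.
have tN : - N < t < N by rewrite -ltr_norml /N ltrDl.
have /andP[Nt tN'] := tN.
have [dG GE] := continuous_FTC1_closed tN' (itg _ _) Nt (cf t).
apply: (near_eq_is_derive (f := fun s => G s - G 0)).
- near=> s; rewrite E//; near: s; [exact: lt_nbhsr|exact: lt_nbhsl].
- rewrite -GE derive1E -[X in is_derive _ _ _ X]subr0.
  by apply: is_deriveB; exact: derivableP.
Unshelve. all: by end_near. Qed.

End one_variable.

(** * Differentiation under the integral sign *)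

Section parametric_integral.
Context {R : realType}.
Local Notation E := 'rV[R]_3.

Lemma coord_le_norm n (v : 'rV[R]_n) i : `|v 0 i| <= `|v|.
Proof.
rewrite [leRHS]/Num.Def.normr/= mx_normrE.
exact: (le_bigmax _ (fun ij : 'I_1 * 'I_n => `|v ij.1 ij.2|) (0, i)).
Qed.

Lemma differentiable_rV3 (f : E -> R) (a x : E) :
  (forall e : R, 0 < e -> \forall h \near (0 : E),
     `|f (h + x) - f x - \sum_(i < 3) h 0 i * a 0 i| <= e * `|h|) ->
  differentiable f x /\ forall i, partial i f x = a 0 i.
Proof.
move=> H.
pose L (h : E) : R := \sum_(i < 3) h 0 i * a 0 i.
have linL : linear L.
  move=> c u v; rewrite /L scaler_sumr -big_split; apply: eq_bigr => i _ /=.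
  by rewrite !mxE mulrDl scalerAl.
pose Lf : {linear E -> R} := HB.pack L (GRing.isLinear.Build R E R _ L linL).
have cL : continuous Lf.
  apply: continuous_fun_sum => i; apply: continuous_funM.
    exact: coord_continuous.
  by move=> y; exact: cst_continuous.
have fo : f \o shift x = cst (f x) + Lf +o_ (0 : E) id.
  apply/eqaddoP => e e0; near=> h.
  rewrite /= opprD addrA.
  by near: h; exact: H.
have dfE := diff_unique cL fo.
have df : differentiable f x by apply/diff_locallyP; rewrite dfE.
split=> // i; rewrite /partial deriveE// dfE /= /L (bigD1 i)//= big1 => [|k ki].
  by rewrite addr0 mxE !eqxx mul1r.
by rewrite mxE (negbTE ki) andbF mul0r.
Unshelve. all: by end_near. Qed.

(** The tube lemma: continuity at each point (t, s) gives a neighbourhood of [t] depending on [s],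
    and compactness of the segment makes it uniform. *)
Lemma continuous_compact_near (T : topologicalType) (k : T * R -> R) (t : T)
    (a b e : R) : continuous k -> 0 < e ->
  \forall y \near t, forall s, a <= s <= b -> `|k (y, s) - k (t, s)| <= e.
Proof.
move=> ck e0.
have /compact_near_coveringP cpt := @segment_compact R a b.
have := cpt _ (nbhs t) (fun y s => `|k (y, s) - k (t, s)| <= e) (nbhs_filter t).
move=> H.
suff /H : forall s, `[a, b]%classic s ->
    \forall s' \near s & y \near nbhs t, `|k (y, s') - k (t, s')| <= e.
  by apply: filterS => y Hy s sab; apply: Hy; rewrite /= in_itv.
move=> s _.
have e20 : 0 < e / 2 by rewrite divr_gt0.
have /cvgrPdist_le/(_ _ e20)[[U V] /= [tU sV] UV] := ck (t, s).
exists (V, U) => // -[s' y] /= [Vs' Uy].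
rewrite -(subrKA (k (t, s))) (splitr e) (le_trans (ler_normD _ _))// lerD//.
  by rewrite distrC; exact: (UV (y, s')).
by apply: (UV (t, s')); split => //=; exact: nbhs_singleton.
Qed.

Lemma derive_along (f : E -> R) (h p : E) (q : R) :
  (forall x, differentiable f x) ->
  is_derive q 1 (fun q => f (q *: h + p))
    (\sum_(i < 3) h 0 i * partial i f (q *: h + p)).
Proof.
move=> df; apply/is_derive_line; rewrite -derive_sum_partial//.
by apply/derivableP/diff_derivable.
Qed.

Variables (I K : E -> R -> R).
Hypothesis I0 : forall t, I t 0 = 0.
Hypothesis dI : forall t (s : R), is_derive s 1 (I t) (K t s).
Hypothesis dK : forall s t, differentiable (K ^~ s) t.
Hypothesis cK :
  forall i, continuous (fun p : E * R => partial i (K ^~ p.2) p.1).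

Let J i t s := oriented_integral 0 s (fun s => partial i (K ^~ s) t).

Let dJ i t (s : R) : is_derive s 1 (J i t) (partial i (K ^~ s) t).
Proof.
apply: is_derive_oriented_integral => r.
apply: (@continuous_comp _ _ _ (pair t) (fun p : E * R => partial i (K ^~ p.2) p.1)).
  exact: (@cvg_pair _ _ _ (nbhs r) (nbhs t) (nbhs r) _ _ _ (fun _ => t) id (cvg_cst t) cvg_id).
exact: cK.
Qed.

Let J0 i t : J i t 0 = 0.
Proof.
by rewrite /J /oriented_integral lexx set_itv1 Rintegral_set1.
Qed.

Let near_partial (t : E) (e : R) : 0 < e -> \forall y \near t,
  forall i s, `|s| <= 1 ->
  `|partial i (K ^~ s) y - partial i (K ^~ s) t| <= e.
Proof.
move=> e0.
apply: (@filter_forall E 'I_3 (fun i y => forall s, `|s| <= 1 ->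
    `|partial i (K ^~ s) y - partial i (K ^~ s) t| <= e) (nbhs t) _) => i.
have := @continuous_compact_near _ _ t (-1) 1 _ (@cK i) e0.
by apply: filterS => y Hy s; rewrite ler_norml; exact: Hy.
Qed.

(** [I t s] is the integral of [K t] from 0 to [s], described only by its derivative and its value
    at 0, and [J i t 1] is the candidate for its partial derivative. Two mean value inequalities
    bound the error: one in [s], which replaces [I] by [K], and one along the segment from [t] to
    [h + t], which replaces [K] by its partial derivatives. *)
Lemma Ck1_parametric : Ck 1 (fun t => I t 1).
Proof.
have D t : differentiable (fun t => I t 1) t /\
    forall i, partial i (fun t => I t 1) t = (\row_i J i t 1) 0 i.
  apply: differentiable_rV3 => e e0.
  (* Each of the three coordinates will contribute at most |h| e / 3. *)
  have e3 : 0 < e / 3 by rewrite divr_gt0.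
  have := near_partial t _ e3.
  rewrite (near_shift 0) subr0 => /nbhs_ballP[/= d d0 dH].
  apply/nbhs_ballP; exists d => //= h; rewrite -ball_normE/= sub0r normrN => hd.
  pose phi s := I (h + t) s - I t s - \sum_(i < 3) h 0 i * J i t s.
  have dphi (s : R) : is_derive s 1 phi
      (K (h + t) s - K t s - \sum_(i < 3) h 0 i * partial i (K ^~ s) t).
    apply: is_deriveB.
    have -> : (fun s => \sum_(i < 3) h 0 i * J i t s) =
        \sum_(i < 3) (fun s => h 0 i * J i t s).
      by apply/funext => r; rewrite fct_sumE.
    by apply: is_derive_sum => i; apply: is_deriveZ.
  have := @mean_value_inequality R phi _ 1 (e * `|h|) dphi.
  have -> : phi 0 = 0.
    by rewrite /phi !I0 subrr big1 ?subrr// => i _; rewrite J0 mulr0.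
  rewrite normr1 mulr1 subr0 /phi.
  under eq_bigr do rewrite mxE.
  apply => s s1.
  (* For fixed [s], this is [K] along the segment minus its linearization at [t], so its derivative
     is a sum of three differences of partial derivatives, each controlled by [near_partial]. *)
  pose psi q := K (q *: h + t) s - q * \sum_(i < 3) h 0 i * partial i (K ^~ s) t.
  have dpsi (q : R) : is_derive q 1 psi
     (\sum_(i < 3) h 0 i * partial i (K ^~ s) (q *: h + t)
      - \sum_(i < 3) h 0 i * partial i (K ^~ s) t).
    apply: is_deriveB; first exact: derive_along.
    exact: is_derive_mulr.
  have := @mean_value_inequality R psi _ 1 (e * `|h|) dpsi.
  rewrite normr1 mulr1 /psi scale1r scale0r add0r mul1r mul0r subr0 addrAC.
  apply => q q1; rewrite -sumrB.
  rewrite (le_trans (ler_norm_sum _ _ _))//.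
  have -> : e * `|h| = \sum_(i < 3) `|h| * (e / 3).
    by rewrite sumr_const card_ord; field.
  apply: ler_sum => i _; rewrite -mulrBr normrM ler_pM//.
    exact: coord_le_norm.
  apply: dH => //; rewrite -ball_normE/= sub0r normrN normrZ.
  by apply: le_lt_trans hd; rewrite ler_piMl.
apply: Ck1_partial => [t|i]; first by have [] := D t.
have -> : partial i (fun t => I t 1) = fun t => J i t 1.
  by apply/funext => t; have [_ ->] := D t; rewrite mxE.
(* J i y 1 - J i t 1 is the increment over [0, 1] of a function of [s] whose derivative is at most
   [e] once [y] is close to [t]. *)
move=> t; apply/(cvgrPdist_le (FF := nbhs_filter (t : E))) => e e0.
have := near_partial t _ e0; apply: filterS => y /(_ i) Hy.
rewrite distrC.
have dd (s : R) : is_derive s 1 (fun s => J i y s - J i t s)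
    (partial i (K ^~ s) y - partial i (K ^~ s) t).
  by apply: is_deriveB.
have := @mean_value_inequality R (fun s => J i y s - J i t s) _ 1 e dd.
by rewrite normr1 mulr1 (J0 i y) (J0 i t) (subrr (0 : R)) subr0; apply; exact: Hy.
Qed.

End parametric_integral.

(** * Antiderivatives along one coordinate *)

Section antiderivative.
Context {R : realType}.
Local Notation E := 'rV[R]_3.

(** Nothing is assumed about [W] in the directions other than [k]. [W t] is the integral of [F] from
    0 to t_k in the coordinate [k]; the substitution r = s t_k makes the interval [0, 1] independent
    of [t], after which the parameter can be differentiated. *)
Lemma Ck1_antiderivative (k : 'I_3) (W F : E -> R) : Ck 1 F ->
  (forall t, is_derive t (delta_mx 0 k) W (F t)) ->
  (forall t : E, t 0 k = 0 -> W t = 0) -> Ck 1 W.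
Proof.
move=> F1 dW W0.
(* [S s] multiplies the coordinate [k] by [s] and fixes the others. It joins the projection onto t_k
   = 0, where [W] vanishes, to the identity, with velocity t_k times the basis vector [k]; hence the
   factor t_k in [K]. *)
pose m (l : 'I_3) (s : R) : R := if l == k then s else 1.
pose S (s : R) (t : E) : E := \row_l (m l s * t 0 l).
have S1 s : Ck 1 (S s).
  by apply: Ck1_row => l; apply: Ck1M; [exact: Ck1_cst|exact: Ck1_coord].
have SE s t : S s t = (s * t 0 k) *: delta_mx 0 k + S 0 t.
  apply/rowP => l; rewrite !mxE /m /=.
  by case: eqP => [->|_]; rewrite ?mulr1 ?mul0r ?addr0// mulr0 add0r.
have S11 t : S 1 t = t by apply/rowP => l; rewrite mxE /m if_same mul1r.
have -> : W = fun t => W (S 1 t) by apply/funext => t; rewrite S11.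
have dS s t i l : partial i (comp3 (S s) l) t = m l s * (delta_mx 0 i : E) 0 l.
  have -> : comp3 (S s) l = fun t => m l s * t 0 l.
    by apply/funext => y; rewrite /comp3 mxE.
  rewrite /partial deriveM_pt; first last.
  - by have [] := Ck1_coord (R := R) l.
  - exact: differentiable_cst.
  by rewrite derive_cst mulr0 addr0 derive_coordE.
pose K (t : E) s := t 0 k * F (S s t).
have dFS s : Ck 1 (F \o S s) by exact: Ck1_comp.
have K1 s : Ck 1 (K ^~ s) by apply: Ck1M; [exact: Ck1_coord|exact: dFS].
have KE s t i : partial i (K ^~ s) t =
    t 0 k * \sum_(l < 3) m l s * (delta_mx 0 i : E) 0 l * partial l F (S s t)
    + F (S s t) * (delta_mx 0 i : E) 0 k.
  rewrite /partial deriveM_pt; first last.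
  - by have [] := dFS s.
  - by have [] := Ck1_coord (R := R) k.
  rewrite derive_coordE -[fun x => F (S s x)]/(F \o S s) derive_comp_partial.
  - by congr (_ * _ + _); apply: eq_bigr => l _; rewrite -(dS s t i l).
  - by have [] := S1 s.
  - by have [] := F1.
have cm l : continuous (m l).
  by rewrite /m; case: eqP => _ x; [exact: cvg_id|exact: cst_continuous].
have cS : continuous (fun p : E * R => S p.2 p.1).
  apply: continuous_row => l; apply: continuous_funM => p.
    by apply: continuous_comp; [exact: cvg_snd|exact: cm].
  apply: (@continuous_comp _ _ _ fst (fun M : E => M 0 l)).
    exact: cvg_fst.
  exact: coord_continuous.
apply: (@Ck1_parametric R (fun t s => W (S s t)) K).
- by move=> t; apply: W0; rewrite mxE /m eqxx mul0r.
- move=> t s.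
  pose g r := W (r *: delta_mx 0 k + S 0 t).
  have -> : (fun s => W (S s t)) = g \o (fun s => s * t 0 k).
    by apply/funext => r; rewrite /g /= -SE.
  rewrite /K mulrC; apply: is_derive1_comp.
    by rewrite SE; apply/is_derive_line.
  exact: is_derive_mulr.
- by move=> s t; have [] := K1 s.
- move=> i.
  under eq_fun do rewrite KE.
  have cst0 (c : R) : continuous (fun _ : E * R => c).
    by move=> p; exact: cst_continuous.
  have c0 : continuous (fun p : E * R => p.1 0 k).
    move=> p; apply: (@continuous_comp _ _ _ fst (fun M : E => M 0 k)).
      exact: cvg_fst.
    exact: coord_continuous.
  apply: continuous_funD; apply: continuous_funM => //.
    apply: continuous_fun_sum => l; apply: continuous_funM.
      apply: continuous_funM => // p.
      by apply: continuous_comp; [exact: cvg_snd|exact: cm].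
    move=> p; apply: continuous_comp; first exact: cS.
    by have [_] := F1; exact.
  move=> p; apply: continuous_comp; first exact: cS.
  exact: Ck1_continuous.
Qed.

End antiderivative.

(** * Sigma-finiteness of a product measure *)

Section product_sigma_finite.
Local Open Scope ereal_scope.
Context d1 d2 (T1 : measurableType d1) (T2 : measurableType d2) (R : realType).
Variables (m1 : {sigma_finite_measure set T1 -> \bar R})
  (m2 : {sigma_finite_measure set T2 -> \bar R}).

Lemma product_measure1_sigma_finite : sigma_finite setT (m1 \x m2).
Proof.
have /sigma_finiteP[F [FT Fnd Foo]] := sigma_finiteT m1.
have /sigma_finiteP[G [GT Gnd Goo]] := sigma_finiteT m2.
exists (fun n => F n `*` G n).
  apply/esym/seteqP; split=> // -[x y] _.
  have [a _ Fx] : (\bigcup_n F n) x by rewrite -FT.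
  have [b _ Gy] : (\bigcup_n G n) y by rewrite -GT.
  (* Both exhaustions are nondecreasing, so the larger index serves for the two coordinates. *)
  exists (maxn a b) => //; split => /=.
    by have /subsetPset := Fnd _ _ (leq_maxl a b); apply.
  by have /subsetPset := Gnd _ _ (leq_maxr a b); apply.
move=> n; have [mF Fn] := Foo n; have [mG Gn] := Goo n.
split; first exact: measurableX.
by rewrite product_measure1E//= lte_mul_pinfty// ge0_fin_numE.
Qed.

(** The product packed with its sigma-finiteness, so that Fubini's theorem can be applied again when
    it is a factor of a threefold product. *)
Definition sigma_finite_product : {sigma_finite_measure set (T1 * T2)%type -> \bar R}%R :=
  HB.pack (m1 \x m2) (Measure_isSigmaFinite.Build _ _ _ (m1 \x m2)
    product_measure1_sigma_finite).

End product_sigma_finite.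

(** * Measurability, integrability and integration by parts on R^3 *)

Section lebesgue3.
Context {R : realType}.
Local Notation E := 'rV[R]_3.
Local Notation mu := (@lebesgue_measure R).
Local Notation RR := (measurableTypeR R).
Local Notation T3 := (RR * RR * RR)%type.

Lemma continuous_point3 : continuous (@point3 R).
Proof.
apply: continuous_row => i p.
have c1 : (fun q : R * R * R => q.1.1) @ p --> p.1.1.
  by apply: (@cvg_comp _ _ _ fst fst); exact: cvg_fst.
have c2 : (fun q : R * R * R => q.1.2) @ p --> p.1.2.
  by apply: (@cvg_comp _ _ _ fst snd); [exact: cvg_fst|exact: cvg_snd].
have c3 : (fun q : R * R * R => q.2) @ p --> p.2 by exact: cvg_snd.
by case: i => -[|[|[|//]]] /=.
Qed.

Lemma rat_ball (x e : R) : 0 < e -> exists q : rat, `|x - ratr q| < e.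
Proof.
move=> e0; have : x - e < x + e by lra.
move=> /rat_in_itvoo[q]; rewrite in_itv/= => qe; exists q.
by rewrite ltr_norml; lra.
Qed.

(** The sigma-algebra is the product one, generated by rectangles; an open set belongs to it as a
    countable union of boxes with rational centres and radii 1/(n+1). *)
Lemma open_measurable3 (U : set (R * R * R)) : open U -> measurable (U : set T3).
Proof.
move=> oU.
pose box (i : rat * rat * rat * nat) : set (R * R * R) :=
  (ball (ratr i.1.1.1 : R) i.2.+1%:R^-1 `*` ball (ratr i.1.1.2 : R) i.2.+1%:R^-1)
  `*` ball (ratr i.1.2 : R) i.2.+1%:R^-1.
pose F i := if `[< box i `<=` U >] then box i else set0.
have -> : U = \bigcup_i F i.
  apply/seteqP; split=> [p Up|p [i _]]; last first.
    by rewrite /F; case: ifPn => // /asboolP; apply.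
  have /nbhs_ballP[/= e e0 eU] : nbhs p U by exact: open_nbhs_nbhs.
  (* With radius below e / 2, a box containing [p] lies in the ball of radius [e] around [p], hence
     in [U]. *)
  pose n := Num.truncn (e / 2)^-1.
  have n2 : n.+1%:R^-1 < e / 2.
    by rewrite invf_plt ?posrE ?divr_gt0// truncnS_gt.
  have n0 : 0 < n.+1%:R^-1 :> R by rewrite invr_gt0.
  have [q1 Q1] := rat_ball p.1.1 _ n0.
  have [q2 Q2] := rat_ball p.1.2 _ n0.
  have [q3 Q3] := rat_ball p.2 _ n0.
  exists (q1, q2, q3, n) => //; rewrite /F.
  case: asboolP => [_|[]]; first by rewrite /box -!ball_normE /=; split; first split;
    rewrite /= distrC.
  have tri (x y q : R) : `|x - q| < n.+1%:R^-1 -> `|q - y| < n.+1%:R^-1 -> `|x - y| < e.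
    move=> xq qy; rewrite -(subrKA q) (le_lt_trans (ler_normD _ _))//.
    rewrite (splitr e) ltrD// ?(lt_trans xq)// (lt_trans qy)//.
  move=> -[[y1 y2] y3]; rewrite /box -!ball_normE /= => -[[Y1 Y2] Y3].
  apply: eU; split; first split; rewrite -ball_normE /=.
  - exact: tri Q1 Y1.
  - exact: tri Q2 Y2.
  - exact: tri Q3 Y3.
apply: countable_bigcupT_measurable => // i.
rewrite /F; case: ifPn => // _.
by apply: measurableX; [apply: measurableX|]; exact: measurable_ball.
Qed.

Lemma measurable_continuous3 (f : E -> R) : continuous f ->
  measurable_fun setT (f \o @point3 R : T3 -> R).
Proof.
move=> cf; apply: (measurability _ (RGenOpens.measurableE R)).
move=> _ [_ [a [b ->] <-]]; rewrite setTI; apply: open_measurable3.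
apply: open_comp; last exact: interval_open.
move=> p _; apply: continuous_comp; first exact: continuous_point3.
exact: cf.
Qed.

Lemma measurable_point3_compact (K : set E) : compact K ->
  measurable (@point3 R @^-1` K : set T3).
Proof.
move=> cK; rewrite -[X in measurable X]setCK preimage_setC.
apply: measurableC; apply: open_measurable3; apply: open_comp.
  by move=> p _; exact: continuous_point3.
rewrite openC; apply: compact_closed => //; exact: norm_hausdorff.
Qed.

Lemma continuous_Linfty_loc (f : E -> R) : continuous f -> Linfty_loc f.
Proof.
move=> cf K cK.
have mf : measurable_fun setT ((f \_ K) \o @point3 R : T3 -> R).
  have -> : (f \_ K) \o @point3 R = (f \o @point3 R) \_ (@point3 R @^-1` K).
    by apply/funext => p; rewrite /patch /= /in_mem.
  apply/(measurable_restrictT (T1 := T3) (f \o @point3 R) (measurable_point3_compact K cK)).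
  apply: measurable_funTS; exact: measurable_continuous3.
have [M [Mreal fM]] : bounded_set (f @` K).
  by apply/compact_bounded/continuous_compact => //; exact: continuous_subspaceT.
have bM p : `|((f \_ K) \o @point3 R) p| <= `|M| + 1.
  rewrite /= patchE; case: ifPn => [/set_mem Kp|_].
    by apply: fM; [rewrite (le_lt_trans (ler_norm _))// ltrDl|exists (point3 p)].
  by rewrite normr0 addr_ge0.
rewrite /Lfun inE; apply/andP; split; first by rewrite inE.
rewrite inE /= /finite_norm unlock /=.
case: ifPn => // _.
apply: (@le_lt_trans _ _ (`|M| + 1)%:E); last exact: ltry.
apply/ess_supP; apply/aeW => p /=.
by rewrite lee_fin; exact: bM.
Qed.

(** Outside a cube of finite measure [f] is 0, and on the cube it is bounded by compactness. *)
Lemma integrable_compact_support (f : E -> R) (N : R) : continuous f ->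
  (forall x, f x != 0 -> forall i, `|x 0 i| <= N) ->
  (@leb3 R).-integrable setT (EFin \o (f \o @point3 R)).
Proof.
move=> cf fN.
pose I : set RR := `[- N, N]%classic.
pose B : set T3 := (I `*` I) `*` I.
have mI : measurable I by exact: measurable_itv.
have mB : measurable B by apply: measurableX => //; exact: measurableX.
have -> : EFin \o (f \o @point3 R) = (EFin \o (f \o @point3 R)) \_ B.
  apply/funext => p; rewrite patchE; case: ifPn => // /negP pB.
  have [f0|/fN fp] := eqVneq (f (point3 p)) 0; first by rewrite /= f0.
  exfalso; apply: pB; apply/mem_set.
  have h1 := fp 0; have h2 := fp 1; have h3 := fp 2.
  rewrite !mxE /= in h1 h2 h3.
  by split; first split; rewrite /I /= in_itv/= -ler_norml.
apply/(integrable_mkcond _ mB); apply: measurable_bounded_integrable => //.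
- have I2 : (mu I < +oo)%E.
    by apply: compact_finite_measure; exact: segment_compact.
  have f2 : mu I \is a fin_num by rewrite ge0_fin_numE.
  have mII : measurable (I `*` I) by exact: measurableX.
  have BE : @leb3 R B = (mu I * mu I * mu I)%E.
    rewrite -(product_measure1E mu mu mI mI).
    exact: (product_measure1E (mu \x mu)%E mu mII mI).
  suff : (@leb3 R B < +oo)%E by [].
  by rewrite BE -ge0_fin_numE ?mule_ge0// !fin_numM.
- by apply: measurable_funTS; exact: measurable_continuous3.
- have cB : compact [set v : E | forall i, `[- N, N]%classic (v 0 i)].
    apply: (@rV_compact R^o 3 (fun=> `[- N, N]%classic)) => i.
    exact: segment_compact.
  have [M [Mreal fM]] : bounded_set (f @` [set v : E | forall i, `[- N, N]%classic (v 0 i)]).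
    by apply/compact_bounded/continuous_compact => //; exact: continuous_subspaceT.
  exists M; split=> // r Mr p [[p1 p2] p3]; apply: fM => //.
  exists (point3 p) => // i; rewrite mxE.
  by case: i => -[|[|[|//]]].
Qed.

Lemma integral_derivative_eq0 (f df : R -> R) (N : R) :
  (forall x : R, is_derive x 1 f (df x)) -> continuous df ->
  (forall x, f x != 0 -> `|x| <= N) -> (forall x, df x != 0 -> `|x| <= N) ->
  (\int[mu]_x (df x)%:E)%E = 0%E.
Proof.
move=> hf cdf fN dfN.
(* [M] is strictly beyond the support, so [f] is 0 at both ends of [-M, M], and [df] is 0 outside
   this interval. *)
pose M : R := `|N| + 1.
have NM : N < M by rewrite /M (le_lt_trans (ler_norm _))// ltrDl.
have M0 : 0 < M by rewrite ltr_wpDl.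
have cf : continuous f.
  by move=> x; apply/differentiable_continuous/derivable1_diffP; case: (hf x).
have f0 x : M <= `|x| -> f x = 0.
  by move=> Mx; apply/eqP; apply: contraT => /fN; rewrite leNgt (lt_le_trans NM).
transitivity (\int[mu]_(x in `[(- M)%R, M]) (df x)%:E)%E.
  rewrite [RHS]integral_mkcond; apply: eq_integral => x _.
  rewrite patchE; case: ifPn => // /negP xM.
  have [->//|/dfN dx] := eqVneq (df x) 0.
  exfalso; apply: xM; apply/mem_set; rewrite /= in_itv/= -ler_norml.
  exact: (le_trans dx (ltW NM)).
have MM : - M < M by rewrite gtrN.
rewrite (continuous_FTC2 (F := f) MM).
- by rewrite !f0 ?normrN ?(gtr0_norm M0)// subee.
- exact: continuous_subspaceT.
- split.
  + by move=> x _; case: (hf x).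
  + by apply: cvg_at_right_filter; exact: cf.
  + by apply: cvg_at_left_filter; exact: cf.
- by move=> x _; rewrite derive1E; case: (hf x).
Qed.

Lemma integral2_eq0l d1 d2 (T1 : measurableType d1) (T2 : measurableType d2)
    (m1 : {sigma_finite_measure set T1 -> \bar R})
    (m2 : {sigma_finite_measure set T2 -> \bar R}) (f : T1 * T2 -> \bar R) :
  (m1 \x m2)%E.-integrable setT f -> (forall x, \int[m2]_y f (x, y) = 0)%E ->
  (\int[m1 \x m2]_z f z = 0)%E.
Proof.
move=> fi f0; rewrite -(integral12_prod_meas1 fi) /fubini_F.
by under eq_integral do rewrite f0; rewrite integral0.
Qed.

(** Almost everywhere is the natural hypothesis here: Fubini's theorem makes the slices of an
    integrable function integrable only for almost every [y], and the vanishing of their integrals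
    is derived from that integrability. *)
Lemma integral2_eq0r d1 d2 (T1 : measurableType d1) (T2 : measurableType d2)
    (m1 : {sigma_finite_measure set T1 -> \bar R})
    (m2 : {sigma_finite_measure set T2 -> \bar R}) (f : T1 * T2 -> \bar R) :
  (m1 \x m2)%E.-integrable setT f ->
  {ae m2, forall y, \int[m1]_x f (x, y) = 0}%E ->
  (\int[m1 \x m2]_z f z = 0)%E.
Proof.
move=> fi f0; rewrite -(integral21_prod_meas1 fi).
rewrite (ae_eq_integral (cst 0%E)) ?integral0//.
- exact: (measurable_fubini_G fi).
- by apply: filterS f0 => y.
Qed.

(** The condition |x_i| > N is open, so beyond the bound [f] vanishes on a neighbourhood and its
    derivatives vanish too. *)
Lemma partial_support (f : E -> R) (N : R) (k i : 'I_3) (x : E) :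
  (forall x, f x != 0 -> forall i, `|x 0 i| <= N) ->
  partial k f x != 0 -> `|x 0 i| <= N.
Proof.
move=> fN; apply: contraNle => Nx.
have H : \forall y \near x, f y = cst 0 y.
  have : nbhs x [set y : E | N < `|y 0 i|].
    have c : continuous (fun y : E => `|y 0 i|).
      move=> y; apply: (@continuous_comp _ _ _ (fun y : E => y 0 i) (@Num.norm _ R)).
        exact: coord_continuous.
      exact: norm_continuous.
    by have := c x; move=> /cvgr_gt; apply.
  apply: filterS => y Ny; apply/eqP; apply: contraT => /fN/(_ i).
  by rewrite leNgt Ny.
by rewrite /partial (near_eq_derive _ H) derive_cst.
Qed.

(** By Fubini's theorem the coordinate [i] can be integrated first; on each line parallel to that
    axis the integrand is the derivative of a compactly supported function. *)
Lemma integral_partial_eq0 (f : E -> R) (N : R) (i : 'I_3) : Ck 1 f ->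
  (forall x, f x != 0 -> forall i, `|x 0 i| <= N) ->
  (\int[@leb3 R]_p (partial i f (point3 p))%:E = 0)%E.
Proof.
move=> f1 fN.
have [df cf] := f1.
have dfN x : partial i f x != 0 -> forall k, `|x 0 k| <= N.
  by move=> fx k; exact: partial_support fN fx.
have := integrable_compact_support _ _ (cf (delta_mx 0 i)) dfN.
set h := EFin \o _ => hi.
have line (c : R -> E) p : (forall s, c s = s *: delta_mx 0 i + p) ->
    (\int[mu]_s (partial i f (c s))%:E = 0)%E.
  move=> cE.
  have ci s : c s 0 i = s + p 0 i by rewrite cE !mxE !eqxx mulr1.
  (* The parameter [s] differs from the coordinate [i] by the shift p_i, which enlarges the bound on
     the support. *)
  have bd s : `|c s 0 i| <= N -> `|s| <= N + `|p 0 i|.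
    rewrite ci => sN; rewrite -(addrK (p 0 i) s).
    by rewrite (le_trans (ler_normB _ _))// lerD2r.
  apply: (@integral_derivative_eq0 (f \o c) _ (N + `|p 0 i|)).
  - move=> s; have -> : f \o c = fun s => f (s *: delta_mx 0 i + p).
      by apply/funext => r; rewrite /= cE.
    by rewrite cE; apply/is_derive_line/Ck1_is_derive.
  - have cc : continuous c.
      have -> : c = fun s => s *: delta_mx 0 i + p by apply/funext.
      by move=> s; apply: cvgD; [exact: scalel_continuous|exact: cvg_cst].
    by move=> s; apply: (@continuous_comp _ _ _ c (partial i f)); [exact: cc|exact: cf].
  - by move=> s /fN/(_ i)/bd.
  - by move=> s /dfN/(_ i)/bd.
(* [leb3] is convertible to the product of [mm] and [mu]. The axis 2 is the inner variable of this
   splitting; for the axes 1 and 0 the last coordinate is first frozen at a generic [z]. *)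
pose mm := sigma_finite_product _ _ _ _ _ mu mu.
change (\int[mm \x mu]_p h p = 0)%E.
have hmi : (mm \x mu)%E.-integrable setT h by exact: hi.
have [i2|i2] := eqVneq i 2.
  apply: (integral2_eq0l _ _ _ _ mm mu h hmi) => -[x y].
  apply: (line (fun s => point3 (x, y, s)) (point3 (x, y, 0))) => s.
  rewrite i2; apply/rowP => -[[|[|[|//]]] k3]; rewrite !mxE/= ?mulr0 ?mulr1 ?add0r ?addr0//.
apply: (integral2_eq0r _ _ _ _ mm mu h hmi).
have := ae_integrable2 hmi; apply: filterS => z hz.
have [i1|i1] := eqVneq i 1.
  apply: (integral2_eq0l _ _ _ _ mu mu _ hz) => x.
  apply: (line (fun s => point3 (x, s, z)) (point3 (x, 0, z))) => s.
  rewrite i1; apply/rowP => -[[|[|[|//]]] k3]; rewrite !mxE/= ?mulr0 ?mulr1 ?add0r ?addr0//.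
have i0 : i = 0.
  by apply/val_inj; move: i1 i2; case: (i) => -[|[|[|//]]].
apply: (integral2_eq0r _ _ _ _ mu mu _ hz).
apply/aeW => y.
apply: (line (fun s => point3 (s, y, z)) (point3 (0, y, z))) => s.
rewrite i0; apply/rowP => -[[|[|[|//]]] k3]; rewrite !mxE/= ?mulr0 ?mulr1 ?add0r ?addr0//.
Qed.

(** The product of [u] and a test function is C^1 with bounded support, so the integral of its
    partial derivative is 0; the product rule splits it into the two sides. *)
Lemma Ck1_weak_gradient (u : E -> R) (g : E -> E) : Ck 1 u ->
  (forall x i, partial i u x = g x 0 i) -> weak_gradient u g.
Proof.
move=> u1 ug phi i [phik cphi].
have phi1 : Ck 1 phi := phik 1%N.
have [M [Mreal phiM]] := compact_bounded cphi.
pose N : R := `|M| + 1.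
have phiN x : phi x != 0 -> forall k, `|x 0 k| <= N.
  move=> px k; apply: (le_trans (coord_le_norm _ _ _)); apply: phiM.
    by rewrite /N (le_lt_trans (ler_norm _))// ltrDl.
  exact: subset_closure.
have uphi1 : Ck 1 (fun x => u x * phi x) by exact: Ck1M.
have uphiN x : u x * phi x != 0 -> forall k, `|x 0 k| <= N.
  by rewrite mulf_eq0 negb_or => /andP[_]; exact: phiN.
have gc : continuous (comp3 g i).
  have -> : comp3 g i = partial i u by apply/funext => x; rewrite ug.
  by have [_] := u1; exact.
apply/eqP; rewrite -addr_eq0; apply/eqP.
rewrite /integral3 -RintegralD//.
- rewrite /Rintegral -[RHS](_ : fine 0%E = 0 :> R)// -(integral_partial_eq0 _ N i uphi1 uphiN).
  congr fine; apply: eq_integral => p _; congr EFin.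
  have [du _] := u1; have [dphi _] := phi1.
  by rewrite /partial deriveM_pt// -!/(partial i _ _) ug [phi _ * _]mulrC.
- apply: (integrable_compact_support (fun x => u x * partial i phi x) N).
    apply: continuous_funM; first exact: Ck1_continuous.
    by have [_] := phi1; exact.
  move=> x; rewrite mulf_eq0 negb_or => /andP[_ px] k.
  exact: partial_support phiN px.
- apply: (integrable_compact_support (fun x => comp3 g i x * phi x) N).
    by apply: continuous_funM => //; exact: Ck1_continuous.
  by move=> x; rewrite mulf_eq0 negb_or => /andP[_]; exact: phiN.
Qed.

End lebesgue3.

(** * Vector algebra, and derivatives of a pulled back 1-form *)

Section fields.
Context {R : realType}.
Local Notation E := 'rV[R]_3.
Local Notation e_ k := (delta_mx 0 k : E).

Lemma sum3 (F : 'I_3 -> R) : \sum_(i < 3) F i = F 0 + F 1 + F 2.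
Proof.
rewrite !big_ord_recr big_ord0 /= add0r.
by congr (F _ + F _ + F _); exact: val_inj.
Qed.

Lemma ord3D : (0 + 1 = 1 :> 'I_3) * (0 + 2 = 2 :> 'I_3) * (1 + 1 = 2 :> 'I_3) *
  (1 + 2 = 0 :> 'I_3) * (2 + 1 = 0 :> 'I_3) * (2 + 2 = 1 :> 'I_3).
Proof. by do !split; exact: val_inj. Qed.

Lemma dot3_gt0 (u : E) : u != 0 -> 0 < dot3 u u.
Proof.
move=> u0; rewrite lt_def; apply/andP; split; last first.
  by apply: sumr_ge0 => i _; exact: sqr_ge0.
apply: contra u0 => /eqP u0; apply/eqP/rowP => i; rewrite mxE.
have := @psumr_eq0P R 'I_3 xpredT (fun i => u 0 i * u 0 i).
move=> /(_ (fun i _ => sqr_ge0 _) u0 i isT) /eqP.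
by rewrite mulf_eq0 orbb => /eqP.
Qed.

Lemma enorm_sqr (u : E) : enorm u ^+ 2 = dot3 u u.
Proof. by rewrite sqr_sqrtr//; apply: sumr_ge0 => i _; exact: sqr_ge0. Qed.

Lemma cross_cross_dot (u v z : E) : dot3 u v = 0 ->
  dot3 (cross v (cross u v)) z = dot3 v v * dot3 u z.
Proof.
move=> uv; have -> : dot3 (cross v (cross u v)) z =
    dot3 v v * dot3 u z - dot3 u v * dot3 v z.
  by rewrite /dot3 !sum3 !mxE !ord3D; ring.
by rewrite uv mul0r subr0.
Qed.

Lemma cross_self (v : E) (a : R) : cross v (a *: v) = 0.
Proof. by apply/rowP => i; rewrite !mxE; ring. Qed.

Lemma dot3Zr (a : R) (u v : E) : dot3 u (a *: v) = a * dot3 u v.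
Proof. by rewrite /dot3 mulr_sumr; apply: eq_bigr => i _; rewrite mxE mulrCA. Qed.

Lemma crossZr (a : R) (u v : E) : cross u (a *: v) = a *: cross u v.
Proof. by apply/rowP => i; rewrite !mxE; ring. Qed.

Lemma dot3Zl (a : R) (u v : E) : dot3 (a *: u) v = a * dot3 u v.
Proof. by rewrite /dot3 mulr_sumr; apply: eq_bigr => i _; rewrite mxE mulrA. Qed.

Lemma dot3_cross (u v : E) : dot3 u (cross u v) = 0.
Proof. by rewrite /dot3 !sum3 !mxE !ord3D; ring. Qed.

Lemma Ck1_dot3 (F G : E -> E) : (forall l, Ck 1 (comp3 F l)) ->
  (forall l, Ck 1 (comp3 G l)) -> Ck 1 (fun x => dot3 (F x) (G x)).
Proof. by move=> F1 G1; apply: Ck1_sum => l; exact: (Ck1M _ _ (F1 l) (G1 l)). Qed.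

Lemma Ck1_cross (F G : E -> E) : (forall l, Ck 1 (comp3 F l)) ->
  (forall l, Ck 1 (comp3 G l)) -> forall l, Ck 1 (comp3 (fun x => cross (F x) (G x)) l).
Proof.
move=> F1 G1 l.
have -> : comp3 (fun x => cross (F x) (G x)) l = fun x =>
    comp3 F (l + 1) x * comp3 G (l + 2) x + - (comp3 F (l + 2) x * comp3 G (l + 1) x).
  by apply/funext => x; rewrite /comp3 mxE.
by apply: Ck1D; [|apply: Ck1N]; exact: Ck1M.
Qed.

Lemma Ck2_Ck1 (F : E -> E) : Ck 2 F -> Ck 1 F.
Proof. by move=> [dF cF]; split=> // v; exact: Ck1_continuous. Qed.

Lemma Ck1_curl (F : E -> E) : Ck 2 F -> forall l, Ck 1 (comp3 (curl F) l).
Proof.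
move=> F2 l.
have P m k : Ck 1 (partial m (comp3 F k)).
  have -> : partial m (comp3 F k) = comp3 ('D_(e_ m) F) k.
    apply/funext => x; rewrite /partial -derive_coord//.
    by case: F2.
  by apply: Ck1_comp3; have [_] := F2; exact.
have -> : comp3 (curl F) l = fun x => partial (l + 1) (comp3 F (l + 2)) x
                + - partial (l + 2) (comp3 F (l + 1)) x.
  by apply/funext => x; rewrite /comp3 mxE.
by apply: Ck1D => //; exact: Ck1N.
Qed.

(** For [P m l] equal to the partial derivative d_m j_l, the left side is dj(u, v): the
    antisymmetric part of a Jacobian matrix acts as the cross product with the curl. *)
Lemma dot3_cross_curl (P : 'I_3 -> 'I_3 -> R) (u v : E) :
  \sum_(l < 3) v 0 l * (\sum_(m < 3) u 0 m * P m l) -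
  \sum_(l < 3) u 0 l * (\sum_(m < 3) v 0 m * P m l) =
  dot3 (cross (\row_k (P (k + 1) (k + 2) - P (k + 2) (k + 1))) u) v.
Proof. by rewrite /dot3 !sum3 !mxE !ord3D; ring. Qed.

(* [dj(n, v) = (curl j x n) . v], and [dj] commutes with the pullback by [Phi]. *)
Lemma is_derive_pullback (j Phi : E -> E) (n : E -> E) (i k : 'I_3) (t : E) :
  Ck 1 j -> Ck 1 Phi -> (forall l, Ck 1 (comp3 n l)) ->
  (forall x l, partial k (comp3 Phi l) x = n x 0 l) ->
  (forall x, dot3 (j (Phi x)) (n x) = 0) ->
  is_derive t (e_ k)
    (fun x => \sum_(l < 3) j (Phi x) 0 l * partial i (comp3 Phi l) x)
    (dot3 (cross (curl j (Phi t)) (n t)) (\row_l partial i (comp3 Phi l) t)).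
Proof.
move=> j1 Phi1 n1 kPhi jn.
have jl l : Ck 1 (comp3 j l) by exact: Ck1_comp3.
have Pl l : Ck 1 (comp3 Phi l) by exact: Ck1_comp3.
have jPhi l : Ck 1 (comp3 j l \o Phi) by exact: Ck1_comp.
have DjPhi (m l : 'I_3) x : partial m (comp3 j l \o Phi) x =
    \sum_(r < 3) partial m (comp3 Phi r) x * partial r (comp3 j l) (Phi x).
  rewrite /partial derive_comp_partial//; first by case: Phi1.
  by case: (jl l).
(* [Phi] is only C^1, but its derivative along [k] is the C^1 field [n]; Schwarz' theorem yields d_k
   d_i Phi = d_i n. *)
have swap l : is_derive t (e_ k) (partial i (comp3 Phi l)) (partial i (comp3 n l) t).
  apply: (@is_derive_swap R E (comp3 Phi l) (comp3 n l)).
  - by move=> y; have := Ck1_is_derive _ _ y (e_ k) (Pl l); rewrite -/(partial _ _ _) kPhi.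
  - by move=> y; exact: Ck1_is_derive.
  - by move=> y; exact: Ck1_is_derive.
  - by have [_] := n1 l; exact.
(* Differentiating j(Phi) . n = 0 along [i] trades the term j(Phi) . d_i n of the product rule for -
   n . d_i (j o Phi), so that only first derivatives of [j] and [Phi] remain, in antisymmetric
   form. *)
have constraint : \sum_(l < 3) (j (Phi t) 0 l * partial i (comp3 n l) t +
    n t 0 l * partial i (comp3 j l \o Phi) t) = 0.
  have E0 : (fun x => \sum_(l < 3) j (Phi x) 0 l * n x 0 l) = cst 0.
    by apply/funext => x; exact: jn.
  have : is_derive t (e_ i) (fun x => \sum_(l < 3) j (Phi x) 0 l * n x 0 l)
     (\sum_(l < 3) (j (Phi t) 0 l * partial i (comp3 n l) t +
    n t 0 l * partial i (comp3 j l \o Phi) t)).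
    have -> : (fun x => \sum_(l < 3) j (Phi x) 0 l * n x 0 l) =
        \sum_(l < 3) (fun x => j (Phi x) 0 l * n x 0 l).
      by apply/funext => r; rewrite fct_sumE.
    apply: is_derive_sum => l.
    have d1 := Ck1_is_derive _ _ t (e_ i) (jPhi l).
    have d2 := Ck1_is_derive _ _ t (e_ i) (n1 l).
    exact: (is_deriveM d1 d2).
  by rewrite E0 => -[_ <-]; rewrite derive_cst.
have main : is_derive t (e_ k)
    (fun x => \sum_(l < 3) j (Phi x) 0 l * partial i (comp3 Phi l) x)
    (\sum_(l < 3) (j (Phi t) 0 l * partial i (comp3 n l) t +
      partial i (comp3 Phi l) t * partial k (comp3 j l \o Phi) t)).
  have -> : (fun x => \sum_(l < 3) j (Phi x) 0 l * partial i (comp3 Phi l) x) =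
      \sum_(l < 3) (fun x => j (Phi x) 0 l * partial i (comp3 Phi l) x).
    by apply/funext => r; rewrite fct_sumE.
  apply: is_derive_sum => l.
  have d1 := Ck1_is_derive _ _ t (e_ k) (jPhi l).
  exact: (is_deriveM d1 (swap l)).
apply: (is_derive_eq main).
rewrite big_split /=.
move: constraint; rewrite big_split /= => /eqP.
rewrite addr_eq0 => /eqP ->; rewrite addrC.
rewrite -(dot3_cross_curl (fun r l => partial r (comp3 j l) (Phi t))).
congr (_ - _); apply: eq_bigr => l _; rewrite ?mxE; congr (_ * _);
  rewrite DjPhi; apply: eq_bigr => r _; first by rewrite kPhi.
by rewrite mxE.
Qed.

Lemma coord_update (t : E) (k l : 'I_3) (r : R) :
  (r *: e_ k + (t - t 0 k *: e_ k)) 0 l = if l == k then r else t 0 l.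
Proof.
rewrite !mxE /=; case: eqP => [->|_].
  by rewrite !mulr1 subrr addr0.
by rewrite !mulr0 add0r subr0.
Qed.

Lemma is_derive_curve (W : normedModType R) (F : E -> W) (k : 'I_3) (t : E)
    (gam : R -> W) (d : W) :
  (forall r, F (r *: e_ k + (t - t 0 k *: e_ k)) = gam r) ->
  is_derive (t 0 k) 1 gam d -> is_derive t (e_ k) F d.
Proof.
move=> Fgam; have -> : gam = fun r => F (r *: e_ k + (t - t 0 k *: e_ k)).
  by apply/funext.
by move/is_derive_line; rewrite addrC subrK.
Qed.

End fields.

(** * The 1-form of [j] along the flows *)

Section flows.
Context {R : realType}.
Local Notation E := 'rV[R]_3.
Local Notation e_ k := (delta_mx 0 k : E).

Lemma enorm_gt0 (u : E) : u != 0 -> 0 < enorm u.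
Proof. by move=> u0; rewrite sqrtr_gt0 dot3_gt0. Qed.

Lemma Ck1_enorm_sqr (F : E -> E) : (forall l, Ck 1 (comp3 F l)) ->
  Ck 1 (fun x => enorm (F x) ^+ 2).
Proof.
move=> F1; have -> : (fun x => enorm (F x) ^+ 2) = fun x => dot3 (F x) (F x).
  by apply/funext => x; exact: enorm_sqr.
exact: (Ck1_dot3 F F F1 F1).
Qed.

Lemma Ck1_scale (a : E -> R) (F : E -> E) : Ck 1 a -> (forall l, Ck 1 (comp3 F l)) ->
  forall l, Ck 1 (comp3 (fun x => a x *: F x) l).
Proof.
move=> a1 F1 l; have -> : comp3 (fun x => a x *: F x) l = fun x => a x * comp3 F l x.
  by apply/funext => x; rewrite /comp3 mxE.
exact: (Ck1M a (comp3 F l) a1 (F1 l)).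
Qed.

Lemma Ck1_inv_enorm_sqr (F : E -> E) : (forall l, Ck 1 (comp3 F l)) ->
  (forall x, F x != 0) -> Ck 1 (fun x => (enorm (F x) ^+ 2)^-1).
Proof.
move=> F1 F0; apply: (Ck1V (fun x => enorm (F x) ^+ 2) (Ck1_enorm_sqr F F1)) => x.
by rewrite gt_eqF// exprn_gt0// enorm_gt0.
Qed.

Lemma Ck1_inv_enorm (F : E -> E) : (forall l, Ck 1 (comp3 F l)) ->
  (forall x, F x != 0) -> Ck 1 (fun x => (enorm (F x))^-1).
Proof.
move=> F1 F0; apply: (Ck1V (fun x => enorm (F x))) => [|x].
  apply: (Ck1_sqrt (fun x => dot3 (F x) (F x)) (Ck1_dot3 F F F1 F1)) => x.
  exact: dot3_gt0.
by rewrite gt_eqF// enorm_gt0.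
Qed.

Lemma Ck1_of_comp3 (F : E -> E) : (forall l, Ck 1 (comp3 F l)) -> Ck 1 F.
Proof.
move=> F1; have -> : F = fun t => \row_l comp3 F l t.
  by apply/funext => t; apply/rowP => l; rewrite mxE.
exact: Ck1_row.
Qed.

Lemma partial_flow (N : E -> E) (X : R -> E -> E) (F : E -> E) (k l : 'I_3) (t y : E) :
  is_flow N X -> (forall x, differentiable F x) ->
  (forall r, F (r *: e_ k + (t - t 0 k *: e_ k)) = X r y) ->
  partial k (comp3 F l) t = N (F t) 0 l.
Proof.
move=> [_ dX] dF FX; rewrite /partial -derive_coord//.
have Ft : F t = X (t 0 k) y by rewrite -FX addrC subrK.
have := is_derive_curve _ _ _ _ _ _ FX (dX (t 0 k) y).
by rewrite -Ft => -[_ ->].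
Qed.

Definition zero_coord (k : 'I_3) (t : E) : E := t - t 0 k *: e_ k.

Lemma zero_coordE k l t : zero_coord k t 0 l = if l == k then 0 else t 0 l.
Proof. by have := coord_update t k l 0; rewrite scale0r add0r. Qed.

Lemma Ck1_zero_coord k : Ck 1 (zero_coord k).
Proof.
apply: Ck1_of_comp3 => l.
have -> : comp3 (zero_coord k) l = fun t => if l == k then 0 else t 0 l.
  by apply/funext => t; rewrite /comp3 zero_coordE.
by case: eqP => _; [exact: Ck1_cst|exact: Ck1_coord].
Qed.

Lemma partial_zero_coord (f : E -> R) (i k : 'I_3) (x : E) : Ck 1 f -> i != k ->
  partial i (f \o zero_coord k) x = partial i f (zero_coord k x).
Proof.
move=> f1 ik.
suff [_ H] : is_derive x (e_ i) (f \o zero_coord k) (partial i f (zero_coord k x)) by exact: H.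
apply: (is_derive_curve _ _ i _ (fun r => f (r *: e_ i + zero_coord i (zero_coord k x)))).
  move=> r /=; congr f; apply/rowP => l.
  rewrite zero_coordE !coord_update zero_coordE.
  by case: (eqVneq l k) => // ->; rewrite eq_sym (negbTE ik).
have xi : x 0 i = zero_coord k x 0 i by rewrite zero_coordE (negbTE ik).
by apply/is_derive_line; rewrite xi addrC subrK; exact: Ck1_is_derive.
Qed.

(* The coefficient of [dt_i] in the pullback by [Phi] of the 1-form of [j]. *)
Definition pullback (j Phi : E -> E) (i : 'I_3) (t : E) : R :=
  \sum_(l < 3) j (Phi t) 0 l * partial i (comp3 Phi l) t.

Lemma pullback_zero_coord (j Phi : E -> E) (i k : 'I_3) t : Ck 1 Phi -> i != k ->
  pullback j (Phi \o zero_coord k) i t = pullback j Phi i (zero_coord k t).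
Proof.
move=> Phi1 ik; apply: eq_bigr => l _ /=; congr (_ * _).
exact: (partial_zero_coord (comp3 Phi l) i k t (Ck1_comp3 _ l Phi1) ik).
Qed.

Lemma pullback_flow (j Phi N : E -> E) (k : 'I_3) t :
  (forall l, partial k (comp3 Phi l) t = N (Phi t) 0 l) ->
  pullback j Phi k t = dot3 (j (Phi t)) (N (Phi t)).
Proof. by move=> kPhi; apply: eq_bigr => l _; rewrite kPhi. Qed.

Lemma is_derive_pullback_flow (j Phi N : E -> E) (i k : 'I_3) (t : E) :
  Ck 1 j -> Ck 1 Phi -> (forall l, Ck 1 (comp3 N l)) ->
  (forall x l, partial k (comp3 Phi l) x = N (Phi x) 0 l) ->
  (forall x, dot3 (j x) (N x) = 0) ->
  is_derive t (e_ k) (pullback j Phi i)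
    (dot3 (cross (curl j (Phi t)) (N (Phi t))) (\row_l partial i (comp3 Phi l) t)).
Proof.
move=> j1 Phi1 N1 kPhi jN.
have NPhi1 l : Ck 1 (comp3 (N \o Phi) l).
  exact: (Ck1_comp (comp3 N l) Phi (N1 l) Phi1).
exact: (is_derive_pullback j Phi (N \o Phi) i k t j1 Phi1 NPhi1 kPhi
  (fun x => jN (Phi x))).
Qed.

(** The integrating factor exp(-b) makes exp(-b) a constant. *)
Lemma linear_ode (a b db : R -> R) (s : R) :
  (forall s : R, is_derive s 1 b (db s)) ->
  (forall s : R, is_derive s 1 a (db s * a s)) -> b 0 = 0 ->
  a s = expR (b s) * a 0.
Proof.
move=> hb ha b0.
have hE (r : R) : is_derive r 1 (expR \o (fun r => - b r)) (expR (- b r) * - db r).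
  exact: (@is_derive1_comp R expR (fun r => - b r) r _ _
    (is_derive_expR _) (is_deriveN (hb r))).
have : expR (- b s) * a s = expR (- b 0) * a 0.
  apply: (@is_derive_0_is_cst R (fun r => expR (- b r) * a r)) => r.
  apply: (is_derive_eq (is_deriveM (hE r) (ha r))).
  by rewrite /= -![_ *: _]/(_ * _); ring.
rewrite b0 oppr0 expR0 mul1r => <-.
by rewrite mulrA -expRD subrr expR0 mul1r.
Qed.

(** Along the axis [k] each coefficient solves a linear equation with rate f(Phi), of which [W] is
    the antiderivative vanishing on t_k = 0. Both transports are instances: rate |curl j|^2 / |j|^2
    along t3, rate 0 along t2. *)
Lemma pullback_growth (j Phi N : E -> E) (f W : E -> R) (i k : 'I_3) (t : E) :
  Ck 1 j -> Ck 1 Phi -> (forall l, Ck 1 (comp3 N l)) ->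
  (forall x l, partial k (comp3 Phi l) x = N (Phi x) 0 l) ->
  (forall x, dot3 (j x) (N x) = 0) ->
  (forall x v, dot3 (cross (curl j x) (N x)) v = f x * dot3 (j x) v) ->
  (forall x, is_derive x (e_ k) W (f (Phi x))) ->
  (forall x : E, x 0 k = 0 -> W x = 0) ->
  pullback j Phi i t = expR (W t) * pullback j Phi i (zero_coord k t).
Proof.
move=> j1 Phi1 N1 kPhi jN cN dW W0.
pose A := pullback j Phi i.
have dA x : is_derive x (e_ k) A (f (Phi x) * A x).
  have := is_derive_pullback_flow j Phi N i k x j1 Phi1 N1 kPhi jN.
  rewrite cN; have -> // : dot3 (j (Phi x)) (\row_l partial i (comp3 Phi l) x) = A x.
  by apply: eq_bigr => l _; rewrite mxE.
have tE : t = t 0 k *: e_ k + zero_coord k t by rewrite addrC subrK.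
have z0 : 0 *: e_ k + zero_coord k t = zero_coord k t by rewrite scale0r add0r.
have := @linear_ode (fun s => A (s *: e_ k + zero_coord k t))
  (fun s => W (s *: e_ k + zero_coord k t))
  (fun s => f (Phi (s *: e_ k + zero_coord k t))) (t 0 k).
rewrite -tE z0; apply => [s|s|].
- exact/is_derive_line.
- exact/is_derive_line.
- by apply: W0; rewrite zero_coordE eqxx.
Qed.

End flows.

(** * The conductivity exp(w) and its potential *)

Theorem theorem2p4 (R : realType) (j : 'rV[R]_3 -> 'rV[R]_3)
  (X1 X2 X3 : R -> 'rV[R]_3 -> 'rV[R]_3) (x0 : 'rV[R]_3) (w : 'rV[R]_3 -> R) :
  let X32 := fun t3 t2 t1 : R => X3 t3 (X2 t2 (X1 t1 x0)) in
  Ck 2 j ->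
  (forall x, j x != 0) ->
  (forall x, divergence j x = 0) ->
  (forall x, orthogonal_basis (j x) (curl j x) (cross (j x) (curl j x))) ->
  is_flow (fun x => (enorm (j x))^-1 *: j x) X1 ->
  is_flow (fun x => (enorm (curl j x))^-1 *: curl j x) X2 ->
  is_flow (fun x => (enorm (j x) ^+ 2)^-1 *: cross (j x) (curl j x)) X3 ->
  C1_diffeomorphism
    (fun t : 'rV[R]_3 => X32 (t 0 2) (t 0 1) (t 0 0)) ->
  (forall t1 t2 t3 : R,
     w (X32 t3 t2 t1)
     = oriented_integral 0 t3 (fun s =>
         enorm (curl j (X32 s t2 t1)) ^+ 2 / enorm (j (X32 s t2 t1)) ^+ 2)) ->
  isotropically_realizable_with j (expR \o w) /\ Ck 1 (expR \o w).
Proof.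
move=> X32 j2 j_neq0 _ basis flow1 flow2 flow3.
set Phi := fun t => _; move=> -[g [_ gK Phi1 g1]] wE.
have c_neq0 x : curl j x != 0.
  have [B _ _ _] := basis x.
  have := basis_free B; rewrite free_cons => /andP[_]; rewrite free_cons.
  by move=> /andP[+ _]; apply: contraNneq => ->; exact: mem0v.
have jc0 x : dot3 (j x) (curl j x) = 0 by have [] := basis x.
have j1 := Ck2_Ck1 _ j2.
have jl l : Ck 1 (comp3 j l) := Ck1_comp3 j l j1.
have cl := Ck1_curl j j2.
pose f x := enorm (curl j x) ^+ 2 / enorm (j x) ^+ 2.
have jV1 := Ck1_inv_enorm_sqr j jl j_neq0.
have f1 : Ck 1 f.
  exact: (Ck1M (fun x => enorm (curl j x) ^+ 2) (fun x => (enorm (j x) ^+ 2)^-1)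
    (Ck1_enorm_sqr (curl j) cl) jV1).
set n3 := fun x => _ in flow3.
have n31 := Ck1_scale _ _ jV1 (Ck1_cross j (curl j) jl cl) : forall l, Ck 1 (comp3 n3 l).
have jn3 x : dot3 (j x) (n3 x) = 0 by rewrite dot3Zr dot3_cross mulr0.
(* Since j . curl j = 0, the double product curl j x (j x curl j) reduces to |curl j|^2 j. *)
have cn3 x v : dot3 (cross (curl j x) (n3 x)) v = f x * dot3 (j x) v.
  by rewrite crossZr dot3Zl cross_cross_dot// -enorm_sqr mulrA [X in X * _]mulrC.
set n2 := fun x => _ in flow2.
have n21 := Ck1_scale _ _ (Ck1_inv_enorm _ cl c_neq0) cl : forall l, Ck 1 (comp3 n2 l).
have jn2 x : dot3 (j x) (n2 x) = 0 by rewrite dot3Zr jc0 mulr0.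
have cn2 x v : dot3 (cross (curl j x) (n2 x)) v = 0 * dot3 (j x) v.
  by rewrite cross_self mul0r /dot3 big1// => l _; rewrite mxE mul0r.
have dPhi3 t l : partial 2 (comp3 Phi l) t = n3 (Phi t) 0 l.
  apply: (partial_flow n3 X3 Phi 2 l t (X2 (t 0 1) (X1 (t 0 0) x0)) flow3).
    by case: Phi1.
  by move=> r; rewrite /Phi /X32 !coord_update.
(* The restriction of [Phi] to t3 = 0, extended independently of t3 so that lemmas about maps on R^3
   apply. Its derivative along t2 is the second field everywhere, which is not known for [Phi]. *)
pose Psi := Phi \o zero_coord 2.
have PsiE t : Psi t = X2 (t 0 1) (X1 (t 0 0) x0).
  by rewrite /Psi /= /Phi /X32 !zero_coordE /=; have [-> _] := flow3.
have Psi1 : Ck 1 Psi.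
  apply: Ck1_of_comp3 => l.
  exact: (Ck1_comp (comp3 Phi l) _ (Ck1_comp3 _ l Phi1) (Ck1_zero_coord 2)).
have dPsi t : differentiable Psi t by case: Psi1.
have dPsi2 t l : partial 1 (comp3 Psi l) t = n2 (Psi t) 0 l.
  apply: (partial_flow n2 X2 Psi 1 l t (X1 (t 0 0) x0) flow2 dPsi).
  by move=> r; rewrite PsiE !coord_update.
have cphi t2 t1 : continuous (fun s => f (X32 s t2 t1)).
  move=> s; apply: (@continuous_comp _ _ _ (fun s => X32 s t2 t1) f).
    apply/differentiable_continuous/derivable1_diffP.
    by have [_ /(_ s (X2 t2 (X1 t1 x0)))[]] := flow3.
  exact: Ck1_continuous.
pose W := w \o Phi.
have dW t : is_derive t (delta_mx 0 2) W (f (Phi t)).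
  apply: (is_derive_curve _ _ 2 _ (fun r => oriented_integral 0 r
      (fun s => f (X32 s (t 0 1) (t 0 0))))).
    by move=> r; rewrite /W /= /Phi !coord_update wE.
  exact: is_derive_oriented_integral.
have W0 (t : 'rV[R]_3) : t 0 2 = 0 -> W t = 0.
  move=> t0; rewrite /W /= /Phi wE t0 /oriented_integral lexx set_itv1.
  exact: Rintegral_set1.
have W1 : Ck 1 W.
  exact: (Ck1_antiderivative 2 W (f \o Phi) (Ck1_comp f Phi f1 Phi1) dW W0).
have w1 : Ck 1 w.
  have -> : w = W \o g by apply/funext => x; rewrite /W /= gK.
  exact: (Ck1_comp W g W1 g1).
pose h s := enorm (j (X1 s x0)).
have Psi_pullback t : pullback j Psi 0 t = h (t 0 0).
  (* Rate 0 moves the coefficient to t2 = 0, where [Psi] follows [X1] and the coefficient is j .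
     j/|j| = |j|. *)
  rewrite (pullback_growth j Psi n2 (cst 0) (cst 0) 0 1)//.
  rewrite /= expR0 mul1r /pullback; set t' := zero_coord 1 t.
  have Pt' : Psi t' = X1 (t 0 0) x0.
    by rewrite PsiE !zero_coordE /=; have [-> _] := flow2.
  have dPsi1 l : partial 0 (comp3 Psi l) t' = ((enorm (j (Psi t')))^-1 *: j (Psi t')) 0 l.
    apply: (partial_flow (fun x => (enorm (j x))^-1 *: j x) X1 Psi 0 l t' x0 flow1 dPsi).
    move=> r; rewrite PsiE !coord_update zero_coordE /=.
    by have [-> _] := flow2.
  rewrite [LHS](pullback_flow j Psi (fun x => (enorm (j x))^-1 *: j x) 0 t' dPsi1).
  rewrite dot3Zr -enorm_sqr Pt' -/(h _) expr2 mulKf// gt_eqF//.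
  exact: enorm_gt0.
have Phi_pullback i t : pullback j Phi i t = (expR (W t) * h (t 0 0)) *+ (i == 0).
  have [->|i2] := eqVneq i 2; first by rewrite (pullback_flow _ _ n3).
  (* For i different from 2, the projection onto t3 = 0 commutes with d_i, so the initial value is
     the coefficient of [Psi]: [h] for i = 0, and j . n2 = 0 for i = 1. *)
  rewrite (pullback_growth j Phi n3 f W i 2)// -pullback_zero_coord//.
  have [->|i0] := eqVneq i 0; first by rewrite Psi_pullback mulr1n.
  suff -> : i = 1 by rewrite (pullback_flow _ _ n2)// jn2 mulr0.
  by apply/val_inj; move: i0 i2; case: (i) => -[|[|[|//]]].
have ch : continuous h.
  move=> s; apply: (@continuous_comp _ _ _ (X1 ^~ x0) (fun x => enorm (j x))).
    apply/differentiable_continuous/derivable1_diffP.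
    by have [_ /(_ s x0)[]] := flow1.
  apply: (@continuous_comp _ _ _ (fun x => dot3 (j x) (j x)) Num.sqrt).
    exact: (Ck1_continuous _ _ (Ck1_dot3 j j jl jl)).
  exact: sqrt_continuous.
pose H s := oriented_integral 0 s h.
have dH (s : R) : is_derive s 1 H (h s) by exact: is_derive_oriented_integral.
have g01 := Ck1_comp3 g 0 g1.
pose u := H \o comp3 g 0.
have u1 : Ck 1 u.
  by apply: (Ck1_comp1 H h (comp3 g 0) g01) => // x; exact: ch.
pose gradu x := (expR (w x))^-1 *: j x.
have Du x m : partial m u x = gradu x 0 m.
  have PhigE (l : 'I_3) : comp3 Phi l \o g = fun y => y 0 l.
    by apply/funext => y; rewrite /= /comp3 gK.
  have Phig (l : 'I_3) : (delta_mx 0 m : 'rV[R]_3) 0 l =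
      \sum_(i < 3) partial m (comp3 g i) x * partial i (comp3 Phi l) (g x).
    rewrite /partial -(derive_comp_partial (comp3 Phi l)).
    - by rewrite PhigE derive_coordE.
    - by case: g1.
    - by case: (Ck1_comp3 Phi l Phi1).
  (* Pulling the form back by [Phi] and then by its inverse [g] returns [j]. As only the coefficient
     of dt_1 survives, this reads j_m = e^w h(g_0) d_m g_0, that is e^w d_m u. *)
  have jE : \sum_(i < 3) partial m (comp3 g i) x * pullback j Phi i (g x) = j x 0 m.
    transitivity (\sum_(l < 3) j x 0 l * (delta_mx 0 m : 'rV[R]_3) 0 l).
      under [RHS]eq_bigr do rewrite Phig mulr_sumr.
      rewrite exchange_big; apply: eq_bigr => i _; rewrite /pullback mulr_sumr gK.
      by apply: eq_bigr => l _; rewrite mulrCA.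
    rewrite (bigD1 m)//= big1 => [|l lm]; first by rewrite addr0 mxE !eqxx mulr1.
    by rewrite mxE (negbTE lm) andbF mulr0.
  have WE : W (g x) = w x by rewrite /W /= gK.
  rewrite /partial (derive_comp1 H h)//; last by case: g01.
  rewrite mxE -jE sum3 !Phi_pullback /= mulr1n !mulr0n !mulr0 !addr0 WE /partial /comp3.
  by field; rewrite gt_eqF// expR_gt0.
have sigma1 : Ck 1 (expR \o w) := Ck1_expR w w1.
have cV : continuous (fun x => (expR (w x))^-1).
  apply: (Ck1_continuous _ _ (Ck1V (expR \o w) sigma1 _)) => x.
  by rewrite gt_eqF// expR_gt0.
split=> //; split.
- by move=> x; exact: expR_gt0.
- exact: (continuous_Linfty_loc _ (Ck1_continuous _ _ sigma1)).
- exact: (continuous_Linfty_loc _ cV).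
exists u, gradu; split.
  split.
  - exact: (continuous_Linfty_loc _ (Ck1_continuous _ _ u1)).
  - move=> i; apply: continuous_Linfty_loc.
    have -> : comp3 gradu i = partial i u by apply/funext => x; rewrite Du.
    by have [_] := u1; exact.
  - exact: (Ck1_weak_gradient u gradu u1 Du).
apply: aeW => p.
by rewrite /gradu scalerA mulfV ?scale1r// gt_eqF// expR_gt0.
Qed.
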